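(* There exists a function $f\colon \mathbb{N}\to\mathbb{N}$ such that the following holds for every $t\in\mathbb{N}$ and every digraph $D$. Suppose $D$ contains a set $X\subseteq V(D)$ consisting of $2t+1$ vertices such that for all distinct $x,y\in X$ we have $\mu(x,y)>f(t)$. Then $D$ contains the $t$-onion star as an immersion.
   Context: $\mathbb{N}$ is the set of positive integers. Digraphs may have parallel arcs but no loops. Each arc $a$ has a tail $\mathrm{tail}(a)$ and a head $\mathrm{head}(a)$; an arc $xy$ has tail $x$ and head $y$. A path in a digraph $D$ is a sequence $(a_1,\ldots,a_k)$ of pairwise distinct arcs with $\mathrm{head}(a_i)=\mathrm{tail}(a_{i+1})$ for all $1\le i<k$ (vertices may repeat). It is a path from $s$ to $s'$ if $\mathrm{tail}(a_1)=s$ and $\mathrm{head}(a_k)=s'$. Paths are arc-disjoint if they share no arc. For vertices $x,y$ of $D$, $\mu(x,y)$ is the maximum number of pairwise arc-disjoint paths from $x$ to $y$ in $D$. A digraph $D$ contains a digraph $H$ as an immersion if there is a mapping $\pi$ that sends vertices of $H$ to pairwise different vertices of $D$ and each arc $xy$ of $H$ to a path in $D$ from $\pi(x)$ to $\pi(y)$, such that the paths $\pi(a)$, $a\in A(H)$, are pairwise arc-disjoint. For $t\in\mathbb{N}$, the $t$-onion star is the digraph with vertex set $\{x,y_1,\ldots,y_t,z_1,\ldots,z_t\}$ ($2t+1$ distinct vertices) whose arcs are, for each $i\in\{1,\ldots,t\}$: one arc $y_ix$, one arc $xz_i$, two parallel arcs $xy_i$, and two parallel arcs $z_ix$. *)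

(* Defs.v *)
From HB Require Import structures.
From mathcomp Require Import all_boot.

Set Implicit Arguments.
Unset Strict Implicit.
Unset Printing Implicit Defensive.

(* Finite digraphs: arcs are a type of their own, so parallel arcs are allowed. *)
Record digraph := Digraph {
  vertex : finType;
  darc : finType;
  dtail : darc -> vertex;
  dhead : darc -> vertex;
  dloopless : forall a : darc, dtail a != dhead a
}.

(* Arcs are pairwise distinct but vertices may repeat; the empty sequence is
   not a path, since the endpoints are read off the first and last arcs. *)
Definition dipath (D : digraph) (s s' : vertex D) (p : seq (darc D)) : bool :=
  if p is a :: q then
    [&& uniq p, path (fun b c => dhead b == dtail c) a q,
        dtail a == s & dhead (last a q) == s']
  else false.

(* Sets of paths suffice: arc-disjoint paths are nonempty, hence distinct.
   The length bound only makes the type finite; see [leq_mu]. *)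
Definition arc_disjoint_paths (D : digraph) (x y : vertex D)
    (P : {set {bseq #|darc D| of darc D}}) : bool :=
  [forall p in P, dipath x y p]
  && [forall p in P, forall q in P, (p != q) ==> [disjoint p & q]].

Definition mu (D : digraph) (x y : vertex D) : nat :=
  \max_(P : {set {bseq #|darc D| of darc D}} | arc_disjoint_paths x y P) #|P|.

Lemma leq_mu (D : digraph) (x y : vertex D) (k : nat) :
  k <= mu x y <->
  exists p : 'I_k -> seq (darc D),
    (forall i, dipath x y (p i)) /\
    (forall i j, i != j -> [disjoint p i & p j]).
Proof.
split.
- have [P hP ->] : {P | arc_disjoint_paths x y P & mu x y = #|P|}.
    rewrite /mu; apply: eq_bigmax_cond.
    apply/card_gt0P; exists set0; rewrite unfold_in /=.
    by apply/andP; split; apply/forall_inP => p; rewrite inE.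
  move=> le_kP; case/andP: hP => /forall_inP hp /forall_inP hd.
  exists (fun i => bseqval (enum_val (widen_ord le_kP i))); split=> [i|i j ne_ij].
    exact: hp (enum_valP _).
  have /forall_inP/(_ _ (enum_valP (widen_ord le_kP j)))/implyP :=
    hd _ (enum_valP (widen_ord le_kP i)).
  apply; apply: contra ne_ij => /eqP/enum_val_inj/(congr1 val) /= eq_ij.
  exact/eqP/val_inj.
- case=> p [hp hd].
  have le_size i : size (p i) <= #|darc D|.
    have u : uniq (p i) by move: (hp i); case: (p i) => // a q /and4P[].
    by rewrite -(card_uniqP u) max_card.
  pose F i := Bseq (le_size i).
  have F_disj i j : F i != F j -> [disjoint F i & F j].
    by move=> ne; apply: hd; apply: contra ne => /eqP->.
  have F_inj : injective F.
    move=> i j eqF; apply/eqP/negPn/negP => /hd.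
    have -> : p j = p i by exact: (esym (congr1 val eqF)).
    move: (hp i); case: (p i) => // a q _ /pred0P/(_ a) /=.
    by rewrite inE eqxx.
  have <- : #|[set F i | i : 'I_k]| = k by rewrite card_imset // card_ord.
  apply: (leq_bigmax_cond (P := arc_disjoint_paths x y)).
  apply/andP; split; apply/forall_inP => _ /imsetP[i _ ->].
    exact: hp.
  apply/forall_inP => _ /imsetP[j _ ->]; apply/implyP; exact: F_disj.
Qed.

Definition contains_immersion (D H : digraph) : Prop :=
  exists (piV : vertex H -> vertex D) (piA : darc H -> seq (darc D)),
    [/\ injective piV,
        forall a : darc H, dipath (piV (dtail a)) (piV (dhead a)) (piA a)
      & forall a b : darc H, a != b -> [disjoint piA a & piA b]].

Section OnionStar.
Variable t : nat.

Inductive onion_vertex := OX | OY of 'I_t | OZ of 'I_t.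

(* [AYX i] is the arc y_i x, [AXZ i] the arc x z_i; the boolean in [AXY] and
   [AZX] distinguishes the two parallel arcs x y_i, respectively z_i x. *)
Inductive onion_arc :=
  | AYX of 'I_t
  | AXZ of 'I_t
  | AXY of 'I_t & bool
  | AZX of 'I_t & bool.

Definition onion_vertex_code (v : onion_vertex) : option ('I_t + 'I_t) :=
  match v with OX => None | OY i => Some (inl i) | OZ i => Some (inr i) end.

Definition onion_vertex_decode (c : option ('I_t + 'I_t)) : onion_vertex :=
  match c with None => OX | Some (inl i) => OY i | Some (inr i) => OZ i end.

Lemma onion_vertex_codeK : cancel onion_vertex_code onion_vertex_decode.
Proof. by case. Qed.

HB.instance Definition _ :=
  Finite.copy onion_vertex (can_type onion_vertex_codeK).

Definition onion_arc_code (a : onion_arc) :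
    ('I_t + 'I_t) + ('I_t * bool + 'I_t * bool) :=
  match a with
  | AYX i => inl (inl i)
  | AXZ i => inl (inr i)
  | AXY i b => inr (inl (i, b))
  | AZX i b => inr (inr (i, b))
  end.

Definition onion_arc_decode
    (c : ('I_t + 'I_t) + ('I_t * bool + 'I_t * bool)) : onion_arc :=
  match c with
  | inl (inl i) => AYX i
  | inl (inr i) => AXZ i
  | inr (inl (i, b)) => AXY i b
  | inr (inr (i, b)) => AZX i b
  end.

Lemma onion_arc_codeK : cancel onion_arc_code onion_arc_decode.
Proof. by case. Qed.

HB.instance Definition _ := Finite.copy onion_arc (can_type onion_arc_codeK).

Definition onion_tail (a : onion_arc) : onion_vertex :=
  match a with AYX i => OY i | AXZ _ => OX | AXY _ _ => OX | AZX i _ => OZ i end.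

Definition onion_head (a : onion_arc) : onion_vertex :=
  match a with AYX _ => OX | AXZ i => OZ i | AXY i _ => OY i | AZX _ _ => OX end.

Lemma onion_loopless (a : onion_arc) : onion_tail a != onion_head a.
Proof. by case: a. Qed.

Definition onion_star : digraph := Digraph onion_loopless.

End OnionStar.

(* Main.v *)
(** Walks may repeat arcs, since a walk always contains a path with the same ends.

    Let [P_i] be arc-disjoint walks out of [a] and [Q_j] arc-disjoint walks into
    [b] such that every [P_i] meets every [Q_j].  As for stable matchings, the
    [P_i] can be cut to prefixes and the [Q_j] to suffixes such that almost
    every member meets exactly two members of the other side.  Two prefixes that
    meet the same suffix contain a gadget with two walks from [a] to a vertex
    [y] and one from [y] to [b], and dually for [z].  So there are many
    arc-disjoint gadgets of both kinds: either with many distinct vertices, or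
    many of them at a common vertex [u].

    Give every [x] in [X] a block [B x], initially [{x}], that is strongly
    connected inside each of many disjoint arc sets.  By Ramsey's theorem there
    are families of walks inside the blocks and between them such that any two
    families either meet everywhere or are disjoint, and such that they connect
    all blocks strongly.  If no two families meet, [X] itself is connected in
    many disjoint ways and the immersion is immediate.  Otherwise take two
    meeting families [F], [G] whose return route from the end of [G] to the
    start of [F] is shortest; by minimality nothing on the cycle meets anything
    else on it.  Gadgets at distinct vertices then close up, along the route, to
    an onion star centred at the start of [F], and gadgets at a common vertex [u]
    show that [u] can be added to a block.  A block with [2 t + 1] vertices
    contains an onion star, so this ends after boundedly many rounds. *)

Require Import Defs.
From mathcomp Require Import all_boot.
From mathcomp Require Import zify.

Set Implicit Arguments.
Unset Strict Implicit.
Unset Printing Implicit Defensive.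

(** Finite choice by induction on the list. It selects walks and gadgets of which only the existence
    in [Prop] is known. *)
Lemma seq_choice (O : eqType) (T : Type) (t0 : T) (s : seq O)
    (Q : O -> T -> Prop) :
  (forall o, o \in s -> exists x, Q o x) ->
  exists f : O -> T, forall o, o \in s -> Q o (f o).
Proof.
elim: s => [|o s IHs] Hs; first by exists (fun=> t0).
have [x Qox] := Hs o (mem_head o s).
have [o' o's|f Hf] := IHs; first by apply: Hs; rewrite inE o's orbT.
exists (fun o' => if o' == o then x else f o') => o'.
by rewrite inE; case: eqVneq => [->|_] //=; apply: Hf.
Qed.

(** * Homogeneous sequences *)

(** The first entry splits the others by their relation to it, and one of the two classes is large
    enough for induction on [a + b]. Pairs are compared in list order only, which suits relations
    that are not symmetric. *)
Lemma ramsey2 (T : eqType) (r : rel T) (a b : nat) (s : seq T) :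
  2 ^ (a + b) <= size s ->
  exists2 s', subseq s' s &
    a <= size s' /\ pairwise r s' \/
    b <= size s' /\ pairwise (fun x y => ~~ r x y) s'.
Proof.
have [n] := ubnP (a + b); elim: n => // n IHn in a b s *.
case: a => [|a] lt_n; first by exists [::]; rewrite ?sub0seq //; left.
case: b => [|b] in lt_n *; first by exists [::]; rewrite ?sub0seq //; right.
case: s => [|x s] /=; first by rewrite leqNgt expn_gt0.
move=> le_s; have := count_predC (r x) s; rewrite -!size_filter => sz.
have e2 : 2 ^ (a.+1 + b.+1) = 2 ^ (a + b.+1) + 2 ^ (a.+1 + b).
  by rewrite !addnS !addSn expnS mul2n -addnn.
have [le_r|gt_r] := leqP (2 ^ (a + b.+1)) (size (filter (r x) s)).
  have [|s' sub [] [le_s' pw]] := IHn a b.+1 _ _ le_r; first by lia.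
    exists (x :: s').
      by rewrite /= eqxx (subseq_trans sub (filter_subseq _ _)).
    left; split=> //=; rewrite pw andbT; apply/allP=> y /(mem_subseq sub).
    by rewrite mem_filter => /andP[].
  exists s'; last by right.
  exact: subseq_trans sub (subseq_trans (filter_subseq _ _) (subseq_cons _ _)).
have le_r : 2 ^ (a.+1 + b) <= size (filter (predC (r x)) s) by lia.
have [|s' sub [] [le_s' pw]] := IHn a.+1 b _ _ le_r; first by lia.
  exists s'; last by left.
  exact: subseq_trans sub (subseq_trans (filter_subseq _ _) (subseq_cons _ _)).
exists (x :: s').
  by rewrite /= eqxx (subseq_trans sub (filter_subseq _ _)).
right; split=> //=; rewrite pw andbT; apply/allP=> y /(mem_subseq sub).
by rewrite mem_filter => /andP[].
Qed.

Fixpoint ramsey_bound (n K : nat) : nat :=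
  if n is n'.+1 then 2 ^ (ramsey_bound n' K + ramsey_bound n' K) else K.

Lemma ramsey_bound_mono (K n n' : nat) :
  n <= n' -> ramsey_bound n K <= ramsey_bound n' K.
Proof.
move=> /subnK <-; elim: (n' - n) => //= k /leq_trans; apply.
exact: leq_trans (leq_addr _ _) (ltnW (ltn_expl _ _)).
Qed.

(** One relation is made homogeneous at a time; passing to a subsequence keeps what was gained. *)
Lemma ramsey (O T : eqType) (R : O -> rel T) (os : seq O) (K : nat) (s : seq T) :
  ramsey_bound (size os) K <= size s ->
  exists s', [/\ subseq s' s, size s' = K &
    forall o, o \in os ->
      pairwise (R o) s' \/ pairwise (fun x y => ~~ R o x y) s'].
Proof.
elim: os => [|o os IHos] in s *.
  move=> le_K; exists (take K s); split; first exact: take_subseq.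
    by rewrite size_take_min; apply/minn_idPl.
  by move=> o; rewrite in_nil.
move=> /(@ramsey2 _ (R o)) [s1 sub1 H1].
have le1 : ramsey_bound (size os) K <= size s1 by case: H1 => -[].
have [s2 [sub2 sz2 H2]] := IHos _ le1.
exists s2; split=> //; first exact: subseq_trans sub1.
move=> o'; rewrite inE => /orP[/eqP->|]; last exact: H2.
by case: H1 => -[_ /(subseq_pairwise sub2) pw]; [left|right].
Qed.

(** * Stable prefixes *)

Section Meeting.
Variable A : eqType.
Implicit Types p q : seq A.

Definition meets p q := has (mem q) p.

Lemma meetsP p q : reflect (exists2 e, e \in p & e \in q) (meets p q).
Proof. exact: hasP. Qed.

Lemma meetsC p q : meets p q = meets q p.
Proof. exact: has_sym. Qed.

Lemma meetsW p q p' q' :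
  {subset p' <= p} -> {subset q' <= q} -> meets p' q' -> meets p q.
Proof.
move=> sp sq /meetsP[e ep eq]; apply/meetsP.
by exists e; [apply: sp|apply: sq].
Qed.

Section Stop.
Variable m : nat.
Implicit Types S : 'I_m -> seq A.

Definition nmeet p S := #|[set j | meets p (S j)]|.

(** The full length is not searched: [find] returns it by default, so a walk without a shorter
    prefix that meets two members of [S] is left uncut. *)
Definition stop p S := find (fun n => 1 < nmeet (take n p) S) (iota 0 (size p)).

Lemma stop_le p S : stop p S <= size p.
Proof. by rewrite -[leqRHS](size_iota 0) find_size. Qed.

Lemma nmeet_sub p p' S S' :
    {subset p <= p'} -> (forall j, {subset S j <= S' j}) ->
  nmeet p S <= nmeet p' S'.
Proof.
by move=> sp sS; apply: subset_leq_card; apply/subsetP=> j; rewrite !inE; apply: meetsW.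
Qed.

(** With one arc fewer the prefix meets at most one member, and by disjointness its last arc lies on
    at most one more. *)
Lemma nmeet_stop p S :
    (forall j j' e, e \in S j -> e \in S j' -> j = j') ->
  nmeet (take (stop p S) p) S <= 2.
Proof.
move=> dS; case def_n: (stop p S) => [|n].
  by rewrite take0 /nmeet (_ : [set _ | _] = set0) ?cards0 //; apply/setP=> j; rewrite !inE.
have lt_n : n < size p by rewrite -ltnS -def_n ltnS stop_le.
have := @before_find _ 0 (fun n => 1 < nmeet (take n p) S) (iota 0 (size p)) n.
rewrite -/(stop p S) def_n ltnSn nth_iota // add0n => /(_ isT)/negbT.
rewrite -leqNgt => le1.
case: p lt_n def_n le1 => // e0 p lt_n _ le1.
rewrite (take_nth e0 lt_n); set e := nth _ _ _.
apply: (@leq_trans #|[set j | meets (take n (e0 :: p)) (S j)] :|: [set j | e \in S j]|).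
  apply: subset_leq_card; apply/subsetP=> j; rewrite !inE /meets -cats1 has_cat.
  by rewrite /= orbF.
rewrite (leq_trans (leq_card_setU _ _)) // -(addn1 1) leq_add //.
by apply/card_le1_eqP=> j j'; rewrite !inE => ej /dS; apply.
Qed.

Lemma stop_full p S :
  nmeet (take (stop p S) p) S < 2 -> stop p S = size p.
Proof.
move=> lt2; apply/eqP; rewrite eqn_leq stop_le /= leqNgt; apply/negP=> lt_s.
have := @nth_find _ 0 (fun n => 1 < nmeet (take n p) S) (iota 0 (size p)).
rewrite has_find size_iota nth_iota // add0n -/(stop p S) => /(_ lt_s) le2.
by have := leq_trans lt2 le2; rewrite ltnn.
Qed.

Lemma stop_anti p S S' :
  (forall j, {subset S j <= S' j}) -> stop p S' <= stop p S.
Proof.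
move=> sS; apply: sub_find => n /leq_trans; apply.
exact: nmeet_sub.
Qed.

End Stop.


Lemma subset_take p n n' : n <= n' -> {subset take n p <= take n' p}.
Proof. by move=> le_n e; rewrite -(take_takel p le_n); apply: mem_take. Qed.

Section Stable.
Variables (m : nat) (P Q : 'I_m -> seq A).

(* Stopping later on one side makes the other side stop earlier, so the
   composite of the two stopping rules is monotone and has a fixpoint, as in
   the Gale-Shapley theorem. *)
Lemma stable_stops :
  exists p q : 'I_m -> nat,
    (forall i, p i = stop (P i) (fun j => take (q j) (Q j))) /\
    (forall j, q j = stop (Q j) (fun i => take (p i) (P i))).
Proof.
pose Phi (q : 'I_m -> nat) i := stop (P i) (fun j => take (q j) (Q j)).
pose Psi (p : 'I_m -> nat) j := stop (Q j) (fun i => take (p i) (P i)).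
suff [q eq_q] : exists q : 'I_m -> nat, forall j, q j = Psi (Phi q) j by exists (Phi q), q.
have mono (q q' : 'I_m -> nat) : (forall j, q j <= q' j) -> forall j, Psi (Phi q) j <= Psi (Phi q') j.
  move=> le_q j; apply: stop_anti => i; apply: subset_take.
  by apply: stop_anti => j'; apply: subset_take.
(* Starting from 0, the stops only grow under the monotone map, and [n] bounds the room left below
   the total length, so a fixpoint is reached. *)
suff main n (q : 'I_m -> nat) : (forall j, q j <= Psi (Phi q) j) ->
    \sum_j size (Q j) <= n + \sum_j q j -> exists q : 'I_m -> nat, forall j, q j = Psi (Phi q) j.
  by apply: (main (\sum_j size (Q j)) (fun=> 0)) => //; apply: leq_addr.
elim: n => [|n IHn] in q * => le_q le_n.
  exists q => j; apply/eqP; rewrite eqn_leq le_q /=.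
  have le_s i : q i <= size (Q i) by apply: leq_trans (le_q i) (stop_le _ _).
  have eq_s : size (Q j) = q j.
    apply/eqP; rewrite eqn_leq le_s andbT leqNgt; apply/negP=> lt_j.
    move: le_n; rewrite add0n (bigD1 j) // [leqRHS](bigD1 j) //= leqNgt.
    by rewrite -addSn leq_add // leq_sum.
  by rewrite -eq_s stop_le.
have [/forallP/= e|] := boolP [forall j, q j == Psi (Phi q) j].
  by exists q => j; apply/eqP.
rewrite negb_forall => /existsP[j ne_j].
apply: (IHn (Psi (Phi q))); first exact: mono.
apply: leq_trans le_n _; rewrite addSnnS leq_add2l (bigD1 j) //.
by rewrite [leqRHS](bigD1 j) //= -addSn leq_add ?leq_sum // ltn_neqAle ne_j le_q.
Qed.

Lemma sum_nmeet (P' Q' : 'I_m -> seq A) :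
  \sum_i nmeet (P' i) Q' = \sum_j nmeet (Q' j) P'.
Proof.
have count p (S : 'I_m -> seq A) : nmeet p S = \sum_j meets p (S j).
  by rewrite /nmeet -sum1dep_card big_mkcond; apply: eq_bigr => j _; case: meets.
under eq_bigr do rewrite count; rewrite exchange_big.
by apply: eq_bigr => j _; rewrite count; apply: eq_bigr => i _; rewrite meetsC.
Qed.

End Stable.

(** Call a member deficient if it meets fewer than two on the other side. All deficient [P' i] meet
    a deficient [Q' j], so if there is such a [j], there is at most one of them. Otherwise every
    [Q' j] meets at least two, and counting meeting pairs from both sides leaves no deficient
    [P' i]. *)
Lemma few_deficient m (P' Q' : 'I_m -> seq A) :
    (forall i, nmeet (P' i) Q' <= 2) ->
    (forall i j, nmeet (P' i) Q' < 2 -> nmeet (Q' j) P' < 2 -> meets (P' i) (Q' j)) ->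
  #|[set i | nmeet (P' i) Q' < 2]| <= 1.
Proof.
move=> le2 full.
have [/existsP[j lt_j]|] := boolP [exists j, nmeet (Q' j) P' < 2].
  rewrite -ltnS; apply: (leq_ltn_trans _ lt_j); apply: subset_leq_card.
  by apply/subsetP=> i; rewrite !inE => lt_i; rewrite meetsC full.
rewrite negb_exists => /forallP all2.
suff -> : [set i | nmeet (P' i) Q' < 2] = set0 by rewrite cards0.
apply/setP=> i; rewrite !inE; apply/negP=> lt_i.
have: \sum_j nmeet (Q' j) P' < \sum_(j < m) 2.
  rewrite -sum_nmeet (bigD1 i) // [ltnRHS](bigD1 i) //= -addSn leq_add //.
  by apply: leq_sum.
rewrite ltnNge => /negP; apply; apply: leq_sum => j _.
by rewrite leqNgt all2.
Qed.

(** A prefix that meets fewer than two members is uncut, so two of these on opposite sides meet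
    because the original walks do, as [few_deficient] requires. *)
Lemma stable_prefixes m (P Q : 'I_m -> seq A) :
    (forall i i' e, e \in P i -> e \in P i' -> i = i') ->
    (forall j j' e, e \in Q j -> e \in Q j' -> j = j') ->
    (forall i j, meets (P i) (Q j)) ->
  exists p q : 'I_m -> nat,
    let P' i := take (p i) (P i) in let Q' j := take (q j) (Q j) in
    [/\ forall i, nmeet (P' i) Q' <= 2, forall j, nmeet (Q' j) P' <= 2,
        #|[set i | nmeet (P' i) Q' < 2]| <= 1 &
        #|[set j | nmeet (Q' j) P' < 2]| <= 1].
Proof.
move=> dP dQ mPQ; have [p [q [def_p def_q]]] := stable_stops P Q.
exists p, q => P' Q'.
have leP i : nmeet (P' i) Q' <= 2.
  by rewrite /P' def_p nmeet_stop // => j j' e /mem_take ej /mem_take; apply: dQ ej.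
have leQ j : nmeet (Q' j) P' <= 2.
  by rewrite /Q' def_q nmeet_stop // => i i' e /mem_take ei /mem_take; apply: dP ei.
have full i j : nmeet (P' i) Q' < 2 -> nmeet (Q' j) P' < 2 -> meets (P' i) (Q' j).
  move=> lt_i lt_j.
  have -> : P' i = P i.
    by rewrite /P' def_p stop_full ?take_size // -def_p.
  have -> : Q' j = Q j.
    by rewrite /Q' def_q stop_full ?take_size // -def_q.
  exact: mPQ.
split=> //; first exact: few_deficient.
by apply: few_deficient => // j i lt_j lt_i; rewrite meetsC full.
Qed.

End Meeting.

(** * Greedy selection *)

Lemma card_bigcup_leq (I T : finType) (A : {set I}) (F : I -> {set T}) (d : nat) :
  (forall i, i \in A -> #|F i| <= d) -> #|\bigcup_(i in A) F i| <= #|A| * d.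
Proof.
move=> leF; rewrite -sum_nat_const.
elim/big_rec2: _ => [|i k S iA le_k]; first by rewrite cards0.
by apply: leq_trans (leq_card_setU _ _) _; rewrite leq_add ?leF.
Qed.

(** Greedy choice: the fewer than [r] elements chosen before rule out at most [r * D] candidates. *)
Lemma rainbow (T : finType) (N : T -> {set T}) (D r : nat) (S : nat -> {set T}) :
    inhabited T -> (forall u, #|N u| <= D) -> (forall i, i < r -> r * D < #|S i|) ->
  exists f : nat -> T,
    (forall i, i < r -> f i \in S i) /\
    (forall i j, i < j -> j < r -> f j \notin N (f i)).
Proof.
move=> [x0] leN ltS.
suff main k : k <= r -> exists f : nat -> T,
    (forall i, i < k -> f i \in S i) /\
    (forall i j, i < j -> j < k -> f j \notin N (f i)) by apply: main.
elim: k => [|k IHk] lt_k; first by exists (fun=> x0).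
have [f [fS fN]] := IHk (ltnW lt_k).
have: ~~ (S k \subset \bigcup_(i in [set: 'I_k]) N (f i)).
  apply/negP=> /subset_leq_card; apply/negP; rewrite -ltnNge.
  apply: leq_ltn_trans (ltS k lt_k).
  apply: leq_trans (card_bigcup_leq (fun i _ => leN (f (i : 'I_k)))) _.
  by rewrite cardsT card_ord leq_mul2r ltnW ?orbT.
case/subsetPn=> v vS vN.
exists (fun i => if i == k then v else f i); split=> [i|i j lt_ij].
  by rewrite ltnS leq_eqVlt; case: eqP => [->|_] //= /fS.
rewrite ltnS leq_eqVlt; case: eqVneq => [eq_j _|_ /= lt_jk].
  rewrite (ltn_eqF (leq_trans lt_ij _)) ?eq_j //.
  by apply: contra vN => vN; apply/bigcupP; exists (Ordinal (leq_trans lt_ij (eq_leq eq_j))).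
by rewrite (ltn_eqF (ltn_trans lt_ij lt_jk)) fN.
Qed.

(** * Walks and gadgets *)

Lemma split_last (T : Type) (a : pred T) (s : seq T) :
  has a s -> exists s1 x s2, [/\ s = s1 ++ x :: s2, a x & ~~ has a s2].
Proof.
elim: s => //= x s IHs; have [/IHs[s1 [y [s2 [-> ay a2]]]] _|a2] := boolP (has a s).
  by exists (x :: s1), y, s2.
by rewrite orbF => ax; exists [::], x, s.
Qed.

Lemma split_first (T : Type) (a : pred T) (s : seq T) :
  has a s -> exists s1 x s2, [/\ s = s1 ++ x :: s2, a x & ~~ has a s1].
Proof.
elim: s => //= x s IHs; have [ax _|nax /IHs[s1 [y [s2 [-> ay a1]]]]] := boolP (a x).
  by exists [::], x, s.
by exists (x :: s1), y, s2; rewrite /= negb_or nax.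
Qed.

Section Walks.
Variable D : digraph.
Implicit Types (a b c u v : vertex D) (e : darc D) (p q : seq (darc D)).

Fixpoint walk a p b : bool :=
  if p is e :: q then (dtail e == a) && walk (dhead e) q b else a == b.

Lemma walk_catP a p q b :
  reflect (exists2 c, walk a p c & walk c q b) (walk a (p ++ q) b).
Proof.
elim: p a => [|e p IHp] a /=.
  by apply: (iffP idP) => [wq|[c /eqP-> //]]; exists a.
apply: (iffP andP) => [[-> /IHp[c wp wq]]|[c /andP[-> wp] wq]]; first by exists c.
by split=> //; apply/IHp; exists c.
Qed.

Lemma walk_cat a p c q b : walk a p c -> walk c q b -> walk a (p ++ q) b.
Proof. by move=> wp wq; apply/walk_catP; exists c. Qed.

Lemma walk_uniq a p b :
  walk a p b -> exists q, [/\ walk a q b, uniq q & {subset q <= p}].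
Proof.
elim: p a => [|e p IHp] a /=; first by exists [::].
case/andP=> ea /IHp[q [wq uq sq]].
have [eq|neq] := boolP (e \in q).
  case/splitPr: eq wq uq sq => q1 q2 wq uq sq.
  exists (e :: q2); split.
  - by case/walk_catP: wq => c _ /= /andP[_ ->]; rewrite ea.
  - by move: uq; rewrite cat_uniq => /and3P[].
  - move=> x; rewrite inE => /orP[/eqP->|xq]; first exact: mem_head.
    by rewrite inE sq ?orbT // mem_cat inE xq !orbT.
exists (e :: q); split; rewrite /= ?ea ?neq //.
by move=> x; rewrite !inE => /orP[->//|/sq->]; rewrite orbT.
Qed.

Lemma walk_pathE e q b :
  walk (dhead e) q b =
    path (fun e e' => dhead e == dtail e') e q && (dhead (last e q) == b).
Proof. by elim: q e => //= e' q IHq e; rewrite IHq eq_sym andbA. Qed.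

Lemma dipath_walk a p b : dipath a b p -> walk a p b /\ uniq p.
Proof. by case: p => // e q /and4P[-> pq ta hb]; rewrite /= ta walk_pathE pq. Qed.

Lemma walk_dipath a p b : a != b -> walk a p b -> uniq p -> dipath a b p.
Proof.
case: p => [|e q] /=; first by move=> /negPf->.
by move=> _ /andP[-> ]; rewrite walk_pathE => /andP[-> ->] ->.
Qed.

(** The vertices at which a walk passes from one arc to the next; an end counts only if it is also
    passed in between. *)
Definition inner p := [seq dtail e | e <- behead p].

Definition visits p u := has (fun e => (dtail e == u) || (dhead e == u)) p.

Lemma inner_visits p u : u \in inner p -> visits p u.
Proof.
case: p => //= e p /mapP[e' e'p ->]; apply/orP; right.
by apply/hasP; exists e'; rewrite ?eqxx.
Qed.

Lemma inner_suffix p1 p2 : {subset inner p2 <= inner (p1 ++ p2)}.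
Proof.
case: p1 => //= e p1 u /mapP[e' e'p ->]; apply: map_f.
by rewrite mem_cat (mem_behead e'p) orbT.
Qed.

Lemma inner_prefix p1 p2 : {subset inner p1 <= inner (p1 ++ p2)}.
Proof. by case: p1 => //= e p1 u; rewrite /inner /= map_cat mem_cat => ->. Qed.

Lemma visits_prefix p1 p2 u : visits p1 u -> visits (p1 ++ p2) u.
Proof. by rewrite /visits has_cat => ->. Qed.

Lemma visits_suffix p1 p2 u : visits p2 u -> visits (p1 ++ p2) u.
Proof. by rewrite /visits has_cat => ->; rewrite orbT. Qed.

Lemma walk_heads a p b : walk a p b -> rcons (map (@dtail D) p) b = a :: map (@dhead D) p.
Proof. by elim: p a => [|e p IHp] a /= => [/eqP->|/andP[/eqP-> /IHp->]]. Qed.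

(* [w 0] leads from [a] to [v], [w 2] from [v] to [b], and [w 1] is a second
   walk from [a] to [v] (merging) or from [v] to [b] (splitting). *)
Definition gadget (merging : bool) a b v (w : nat -> seq (darc D)) :=
  [/\ walk a (w 0) v, walk v (w 2) b,
      if merging then walk a (w 1) v else walk v (w 1) b &
      forall i j, i < j -> j < 3 -> ~~ meets (w i) (w j)].

(** Of [p1] and [p2], let [r2] be the one whose last common arc [x] with [q], in the order of [q],
    comes earlier, and [r1] the other. Beyond [x], [q] misses [r2] but meets [r1]; let [d] be the
    first arc of [r1] on this part of [q]. The tail of [d] serves as [v]: it is reached along [r1],
    and also along [r2] up to [x] and then along [q], which finally leads on to [b]. *)
Lemma merging_gadget a b c1 c2 c3 p1 p2 q :
    walk a p1 c1 -> walk a p2 c2 -> walk c3 q b -> uniq q ->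
    ~~ meets p1 p2 -> meets p1 q -> meets p2 q ->
  exists v w,
    [/\ gadget true a b v w,
        forall i, i < 3 -> {subset w i <= p1 ++ p2 ++ q},
        v \in inner q & visits p1 v || visits p2 v].
Proof.
move=> wp1 wp2 wq uq dp m1 m2.
have main r1 r2 d1 d2 : walk a r1 d1 -> walk a r2 d2 -> ~~ meets r1 r2 ->
    (exists q1 x q2, [/\ q = q1 ++ x :: q2, x \in r2, ~~ meets q2 r2 & meets r1 q2]) ->
  exists v w,
    [/\ gadget true a b v w,
        forall i, i < 3 -> {subset w i <= r1 ++ r2 ++ q},
        v \in inner q & visits r1 v].
  move=> wr1 wr2 dr [q1 [x [q2 [def_q xr2 dq2 /split_first]]]].
  case=> s1 [d [s2 [def_r1 dq ds1]]].
  have {}dq : d \in q2 := dq; case/splitPr: dq def_q dq2 ds1 => u1 u2 def_q dq2 ds1.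
  case/splitPr: xr2 wr2 dr dq2 => t1 t2 wr2 dr dq2.
  have sq2 : {subset u1 ++ d :: u2 <= q}.
    by move=> e eq; rewrite def_q mem_cat inE eq !orbT.
  exists (dtail d), (nth [::] [:: s1; t1 ++ x :: u1; d :: u2]); split.
  - split=> /=.
    + by move: wr1; rewrite def_r1 => /walk_catP[c ws1 /= /andP[/eqP-> _]].
    + move: wq; rewrite def_q => /walk_catP[c _ /= /andP[_ /walk_catP[c' _ /=]]].
      by rewrite eqxx => /andP[].
    + move: wq; rewrite def_q => /walk_catP[c _ /= /andP[_ /walk_catP[c' wu1 /=]]].
      move=> /andP[/eqP ec' _]; rewrite -ec' in wu1.
      move: wr2 => /walk_catP[c'' wt1 /= /andP[tx _]].
      by apply: walk_cat wt1 _; rewrite /= tx.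
    + have d01 : ~~ meets s1 (t1 ++ x :: u1).
        apply/negP=> /meetsP[e es1]; rewrite mem_cat inE orbA => /orP[et|eu].
          case/negP: dr; apply/meetsP; exists e; rewrite ?def_r1 ?mem_cat ?es1 //.
          by rewrite inE orbA et.
        by case/negP: ds1; apply/hasP; exists e; rewrite //= mem_cat eu.
      have d02 : ~~ meets s1 (d :: u2).
        apply/negP=> /meetsP[e es1 eu].
        by case/negP: ds1; apply/hasP; exists e; rewrite //= mem_cat eu orbT.
      have d12 : ~~ meets (t1 ++ x :: u1) (d :: u2).
        apply/negP=> /meetsP[e]; rewrite mem_cat inE orbA => /orP[et|eu1] eu2.
          case/negP: dq2; apply/meetsP; exists e; first by rewrite mem_cat inE eu2 orbT.
          by rewrite mem_cat inE orbA et.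
        move: uq; rewrite def_q -cat_cons catA cat_uniq => /and3P[_ /negP nh _].
        apply: nh; rewrite -/(meets _ _); apply/meetsP; exists e => //.
        by rewrite mem_cat inE (eu1 : e \in u1) !orbT.
      by case=> [|[|[|i]]] [|[|[|j]]] //.
  - have sr1 : {subset s1 <= r1} by move=> e es; rewrite def_r1 mem_cat es.
    case=> [|[|[|//]]] _ e /=.
    + by move=> /sr1; rewrite !mem_cat => ->.
    + rewrite mem_cat inE orbA => /orP[et|eu].
        by case/orP: et => ee; rewrite !mem_cat inE ee !orbT.
      by rewrite mem_cat [_ \in _ ++ q]mem_cat sq2 ?orbT // mem_cat eu.
    + by move=> eu; rewrite mem_cat [_ \in _ ++ q]mem_cat sq2 ?orbT // mem_cat eu orbT.
  - rewrite def_q; apply: inner_suffix; apply: map_f => /=.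
    by rewrite mem_cat mem_head orbT.
  - by apply/hasP; exists d; rewrite ?eqxx // def_r1 mem_cat mem_head orbT.
(* The last arc of [q] on either walk decides which of them plays [r1]. *)
have: has (fun e => (e \in p1) || (e \in p2)) q.
  by case/meetsP: m1 => e ep1 eq; apply/hasP; exists e; rewrite // ep1.
case/split_last=> q1 [x [q2 [def_q xp dq2]]].
have side r1 r2 : ~~ meets r1 r2 -> meets r2 q -> x \in r1 -> ~~ has (mem r2) q2 ->
    exists q1 x q2, [/\ q = q1 ++ x :: q2, x \in r2, ~~ meets q2 r2 & meets r1 q2].
  move=> dr mr xr1 dr2; have: has (mem r2) q1.
    move: mr; rewrite meetsC def_q /meets has_cat /= (negPf dr2) orbF => /orP[] // xr2.
    by case/negP: dr; apply/meetsP; exists x.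
  case/split_last=> m1' [y [m2' [def_q1 yr2 dm2]]].
  exists m1', y, (m2' ++ x :: q2); split=> //.
  - by rewrite def_q def_q1 -catA.
  - rewrite /meets has_cat /= (negPf dm2) (negPf dr2) orbF /=.
    by apply/negP=> xr2; case/negP: dr; apply/meetsP; exists x.
  - by apply/meetsP; exists x; rewrite ?mem_cat ?mem_head ?orbT.
case/orP: xp => xp.
  have dp2 : ~~ has (mem p2) q2.
    apply: contra dq2 => /hasP[e eq ep2].
    by apply/hasP; exists e; rewrite //= [_ \in p2]ep2 orbT.
  have [v [w [gw sw vq vis]]] := main _ _ _ _ wp1 wp2 dp (side _ _ dp m2 xp dp2).
  by exists v, w; rewrite vis.
have dp1 : ~~ has (mem p1) q2.
  apply: contra dq2 => /hasP[e eq ep1].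
  by apply/hasP; exists e; rewrite //= [_ \in p1]ep1.
rewrite meetsC in dp.
have [v [w [gw sw vq vis]]] := main _ _ _ _ wp2 wp1 dp (side _ _ dp m1 xp dp1).
exists v, w; rewrite vis orbT; split=> // i lt_i e /(sw i lt_i).
by rewrite !mem_cat orbCA.
Qed.

End Walks.

(** * Reversing all arcs *)

Definition rev_digraph (D : digraph) : digraph :=
  @Digraph (vertex D) (darc D) (@dhead D) (@dtail D)
    (fun e => etrans (f_equal negb (eq_sym _ _)) (dloopless e)).

Section Reversal.
Variable D : digraph.
Implicit Types (a b c u v : vertex D) (p q : seq (darc D)).

Lemma walk_rev a p b : @walk D a p b -> @walk (rev_digraph D) b (rev p) a.
Proof.
elim: p a => [|e p IHp] a /= => [/eqP->//|/andP[ea /IHp wp]].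
by rewrite rev_cons -cats1; apply: walk_cat wp _; rewrite /= eqxx.
Qed.

Lemma walk_unrev a p b : @walk (rev_digraph D) a p b -> @walk D b (rev p) a.
Proof.
elim: p a => [|e p IHp] a /= => [/eqP->//|/andP[ea /IHp wp]].
by rewrite rev_cons -cats1; apply: walk_cat wp _; rewrite /= eqxx.
Qed.

(** Reversal reads heads instead of tails, and along a walk the head of each arc is the tail of the
    next. *)
Lemma inner_rev a p b : @walk D a p b -> @inner (rev_digraph D) (rev p) =i @inner D p.
Proof.
case/lastP: p => // p e wp u; rewrite /inner rev_rcons /=.
have := walk_heads wp; rewrite !map_rcons -rcons_cons => /rcons_inj[eq_p _].
by case: p eq_p {wp} => //= e' p [_ eq_p]; rewrite map_rev mem_rev map_rcons eq_p.
Qed.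

Lemma visits_rev p u : @visits (rev_digraph D) (rev p) u = @visits D p u.
Proof. by rewrite /visits has_rev; apply: eq_has => e /=; rewrite orbC. Qed.

Lemma meets_rev p q : meets (rev p) (rev q) = meets p q.
Proof.
by rewrite /meets has_rev; apply: eq_has => e; rewrite /= mem_rev.
Qed.
End Reversal.

Lemma rev3_lt i j : i < j -> j < 3 -> 2 - j < 2 - i.
Proof. lia. Qed.

Lemma splitting_gadget (D : digraph) (a b c1 c2 c3 : vertex D) p q1 q2 :
    walk a p c3 -> walk c1 q1 b -> walk c2 q2 b -> uniq p ->
    ~~ meets q1 q2 -> meets p q1 -> meets p q2 ->
  exists v w,
    [/\ gadget false a b v w,
        forall i, i < 3 -> {subset w i <= p ++ q1 ++ q2},
        v \in inner p & visits q1 v || visits q2 v].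
Proof.
move=> wp wq1 wq2 up dq m1 m2.
have [] := @merging_gadget (rev_digraph D) b a c1 c2 c3 (rev q1) (rev q2) (rev p).
- exact: walk_rev.
- exact: walk_rev.
- exact: walk_rev.
- by rewrite rev_uniq.
- by rewrite meets_rev.
- by rewrite meets_rev meetsC.
- by rewrite meets_rev meetsC.
move=> v [w [[w0 w2 w1 dw] sw vp vis]].
(* The index [2 - i] swaps the first and the last walk, whose roles reversal exchanges, and keeps
   the second parallel walk in the middle. *)
exists v, (fun i => rev (w (2 - i))); split.
- split=> //; [exact: walk_unrev|exact: walk_unrev|exact: walk_unrev|].
  move=> i j lt_ij lt_j; by rewrite meets_rev meetsC dw ?rev3_lt // (leq_ltn_trans (leq_subr _ _)).
- move=> i lt_i e; rewrite mem_rev => /sw; rewrite !mem_cat !mem_rev orbA orbC; apply.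
  exact: leq_ltn_trans (leq_subr _ _) _.
- by rewrite -(inner_rev wp).
- by rewrite -visits_rev -(visits_rev q2).
Qed.

Lemma pick_many (T : finType) (x0 : T) (S : {set T}) (K : nat) :
  K <= #|S| ->
  exists g : nat -> T, (forall k, k < K -> g k \in S) /\
    (forall k l, k < K -> l < K -> g k = g l -> k = l).
Proof.
rewrite cardE => leK; exists (nth x0 (enum S)); split=> [k lt_k|k l lt_k lt_l].
  by rewrite -mem_enum mem_nth // (leq_trans lt_k).
move=> /eqP; rewrite nth_uniq ?enum_uniq ?(leq_trans lt_k) ?(leq_trans lt_l) //.
by move/eqP.
Qed.

(** * Two families of walks that meet everywhere *)

Section Crossing.
Variables (D : digraph) (a b : vertex D) (m : nat) (P Q : nat -> seq (darc D)).
Hypothesis wP : forall i, i < m -> exists c, walk a (P i) c.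
Hypothesis wQ : forall j, j < m -> exists c, walk c (Q j) b.
Hypothesis uP : forall i, i < m -> uniq (P i).
Hypothesis uQ : forall j, j < m -> uniq (Q j).
Hypothesis dP : forall i i', i < m -> i' < m -> i != i' -> ~~ meets (P i) (P i').
Hypothesis dQ : forall j j', j < m -> j' < m -> j != j' -> ~~ meets (Q j) (Q j').
Hypothesis mPQ : forall i j, i < m -> j < m -> meets (P i) (Q j).

Let in_family (p : seq (darc D)) :=
  forall e, e \in p -> exists2 n, n < m & (e \in P n) || (e \in Q n).

(** In the graph on all stable prefixes and suffixes whose edges are the meetings across the two
    sides, closed neighbourhoods have at most 3 elements. The neighbourhood of a member with two
    neighbours contains a gadget, merging for a suffix and splitting for a prefix. Centres at
    distance more than 3 give disjoint gadgets, and a ball of radius 3 has at most 27 elements. The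
    summand 2 covers one deficient member and a strict inequality. *)
Lemma many_gadgets (n : nat) : 2 * n * 27 + 2 <= m ->
  exists (v : nat -> vertex D) (w : nat -> nat -> seq (darc D)) (ip iq : nat -> nat),
    [/\ forall k, k < 2 * n ->
          [/\ gadget (k < n) a b (v k) (w k),
              forall i, i < 3 -> in_family (w k i),
              ip k < m /\ iq k < m &
              if k < n then v k \in inner (Q (iq k)) /\ visits (P (ip k)) (v k)
              else v k \in inner (P (ip k)) /\ visits (Q (iq k)) (v k)],
        forall k l i j, k < 2 * n -> l < 2 * n -> k != l -> i < 3 -> j < 3 ->
          ~~ meets (w k i) (w l j) &
        forall k l, k < 2 * n -> l < 2 * n -> k != l ->
          ip k != ip l /\ iq k != iq l].
Proof.
move=> le_m.
(* Reversing the arc sequences of the [Q j] turns prefixes into suffixes. *)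
have [| |i j|p [q [degP degQ defP defQ]]] := @stable_prefixes _ m P (fun j : 'I_m => rev (Q j)).
- move=> i i' e ei ei'; apply/eqP/negPn/negP => ne.
  by have /negP[] := dP (ltn_ord i) (ltn_ord i') ne; apply/meetsP; exists e.
- move=> i i' e; rewrite !mem_rev => ei ei'; apply/eqP/negPn/negP => ne.
  by have /negP[] := dQ (ltn_ord i) (ltn_ord i') ne; apply/meetsP; exists e.
- have /meetsP[e eP eQ] := mPQ (ltn_ord i) (ltn_ord j).
  by apply/meetsP; exists e; rewrite ?mem_rev.
pose P' (i : 'I_m) := take (p i) (P i).
pose Q' (j : 'I_m) := rev (take (q j) (rev (Q j))).
have eP (i : 'I_m) : P i = P' i ++ drop (p i) (P i) by rewrite cat_take_drop.
have eQ (j : 'I_m) : Q j = rev (drop (q j) (rev (Q j))) ++ Q' j.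
  by rewrite -rev_cat cat_take_drop revK.
have sP (i : 'I_m) : {subset P' i <= P i} by move=> e; rewrite eP mem_cat => ->.
have sQ (j : 'I_m) : {subset Q' j <= Q j}.
  by move=> e; rewrite eQ mem_cat => ->; rewrite orbT.
pose T := ('I_m + 'I_m)%type.
pose arcs (z : T) := match z with inl i => P' i | inr j => Q' j end.
pose near (x y : T) := (x == y) || (match x, y with
   | inl _, inr _ | inr _, inl _ => true | _, _ => false end && meets (arcs x) (arcs y)).
have nearC x y : near x y = near y x.
  by rewrite /near eq_sym meetsC; case: x => i; case: y => j.
have near_refl x : near x x by rewrite /near eqxx.
have far x y : ~~ near x y -> ~~ meets (arcs x) (arcs y).
  rewrite negb_or; case: x => i; case: y => j //= /andP[ne _].
    by apply: contra (dP (ltn_ord i) (ltn_ord j) ne); apply: meetsW; apply: sP.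
  by apply: contra (dQ (ltn_ord i) (ltn_ord j) ne); apply: meetsW; apply: sQ.
pose N1 x := [set y | near x y].
pose N2 x := \bigcup_(y in N1 x) N1 y.
pose N3 x := \bigcup_(y in N2 x) N1 y.
have card1 x : #|N1 x| <= 3.
  have : N1 x \subset x |: match x with
      | inl i => inr @: [set j | meets (P' i) (take (q j) (rev (Q j)))]
      | inr j => inl @: [set i | meets (take (q j) (rev (Q j))) (P' i)] end.
    apply/subsetP=> y; rewrite !inE => /orP[/eqP->|]; first by rewrite eqxx.
    case: x => i; case: y => j //= mt; rewrite imset_f ?orbT // inE.
      by move: mt; rewrite /Q'; apply: meetsW => // e; rewrite mem_rev.
    by move: mt; rewrite /Q'; apply: meetsW => // e; rewrite mem_rev.
  move=> /subset_leq_card/leq_trans; apply.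
  rewrite (leq_trans (leq_card_setU _ _)) // cards1 add1n ltnS.
  by case: x => i; rewrite (leq_trans (leq_imset_card _ _)) //; [apply: degP|apply: degQ].
have card3 x : #|N3 x| <= 27.
  apply: leq_trans (card_bigcup_leq (fun y _ => card1 y)) _; rewrite (_ : 27 = 9 * 3) // leq_mul2r /=.
  apply: leq_trans (card_bigcup_leq (fun y _ => card1 y)) _; rewrite (_ : 9 = 3 * 3) // leq_mul2r /=.
  exact: card1.
pose SQ : {set T} := inr @: [set j | 1 < nmeet (take (q j) (rev (Q j))) P'].
pose SP : {set T} := inl @: [set i | 1 < nmeet (P' i) (fun j => take (q j) (rev (Q j)))].
have card_good (d : 'I_m -> nat) : #|[set i | d i < 2]| <= 1 -> m - 1 <= #|[set i | 1 < d i]|.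
  move=> le1; rewrite leq_subLR -{1}(card_ord m) -(cardsC [set i | d i < 2]) leq_add //.
  by apply: subset_leq_card; apply/subsetP=> i; rewrite !inE -leqNgt.
have [||k lt_k|f [fS fN]] := @rainbow T N3 27 (2 * n) (fun k => if k < n then SQ else SP).
- by constructor; left; apply: (@Ordinal m 0); lia.
- exact: card3.
- have leQ : m - 1 <= #|SQ| by rewrite card_imset; [apply: card_good|apply: inr_inj].
  have leP : m - 1 <= #|SP| by rewrite card_imset; [apply: card_good|apply: inl_inj].
  by case: ifP => _; lia.
pose good k (g : vertex D * (nat -> seq (darc D)) * 'I_m * 'I_m) :=
  let '(v, w, i, j) := g in
  [/\ gadget (k < n) a b v w,
      forall c, c < 3 -> forall e, e \in w c -> exists2 z, z \in N1 (f k) & e \in arcs z,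
      inl i \in N1 (f k) /\ inr j \in N1 (f k) &
      if k < n then v \in inner (Q j) /\ visits (P i) v
      else v \in inner (P i) /\ visits (Q j) v].
have m0 : 0 < m by lia.
have wP' (i : 'I_m) : exists c, walk a (P' i) c.
  by have [c] := wP (ltn_ord i); rewrite eP => /walk_catP[c' wc' _]; exists c'.
have wQ' (j : 'I_m) : exists c, walk c (Q' j) b.
  by have [c] := wQ (ltn_ord j); rewrite eQ => /walk_catP[c' _ wc']; exists c'.
have uP' (i : 'I_m) : uniq (P' i) by rewrite take_uniq ?uP.
have uQ' (j : 'I_m) : uniq (Q' j) by rewrite rev_uniq take_uniq ?rev_uniq ?uQ.
have [|g Hg] := @seq_choice _ _ (a, fun=> [::], Ordinal m0, Ordinal m0) (iota 0 (2 * n)) good.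
  move=> k; rewrite mem_iota add0n => /andP[_ lt_k].
  have := fS k lt_k; case: ifP => lt_kn; last first.
    case/imsetP=> i; rewrite inE => /card_gt1P[j1 [j2 []]]; rewrite !inE => mt1 mt2 ne def_f.
    have mj1 : meets (P' i) (Q' j1) by move: mt1; apply: meetsW => // e; rewrite mem_rev.
    have mj2 : meets (P' i) (Q' j2) by move: mt2; apply: meetsW => // e; rewrite mem_rev.
    have [c1 wc1] := wQ' j1; have [c2 wc2] := wQ' j2; have [c3 wc3] := wP' i.
    have d12 : ~~ meets (Q' j1) (Q' j2).
      by apply: (far (inr j1) (inr j2)); rewrite /near orbF.
    have [v [w [gw sw vp vis]]] := splitting_gadget wc3 wc1 wc2 (uP' i) d12 mj1 mj2.
    have N1j j : meets (P' i) (Q' j) -> inr j \in N1 (f k).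
      by move=> mj; rewrite inE def_f /near /= mj.
    have N1i : inl i \in N1 (f k) by rewrite inE def_f near_refl.
    have vp' : v \in inner (P i) by rewrite eP; apply: inner_prefix.
    have sw' c : c < 3 -> forall e, e \in w c -> exists2 z, z \in N1 (f k) & e \in arcs z.
      move=> lt_c e /(sw c lt_c); rewrite !mem_cat => /or3P[] he.
      - by exists (inl i).
      - by exists (inr j1); rewrite ?N1j.
      - by exists (inr j2); rewrite ?N1j.
    case/orP: vis => vis; [exists (v, w, i, j1)|exists (v, w, i, j2)];
      by split; rewrite ?lt_kn ?N1j //; split=> //; rewrite eQ visits_suffix.
  case/imsetP=> j; rewrite inE => /card_gt1P[i1 [i2 []]]; rewrite !inE => mt1 mt2 ne def_f.
  have mi1 : meets (P' i1) (Q' j).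
    by rewrite meetsC; move: mt1; apply: meetsW => // e; rewrite mem_rev.
  have mi2 : meets (P' i2) (Q' j).
    by rewrite meetsC; move: mt2; apply: meetsW => // e; rewrite mem_rev.
  have [c1 wc1] := wP' i1; have [c2 wc2] := wP' i2; have [c3 wc3] := wQ' j.
  have d12 : ~~ meets (P' i1) (P' i2).
    by apply: (far (inl i1) (inl i2)); rewrite /near orbF.
  have [v [w [gw sw vq vis]]] := merging_gadget wc1 wc2 wc3 (uQ' j) d12 mi1 mi2.
  have N1i i : meets (P' i) (Q' j) -> inl i \in N1 (f k).
    by move=> mi; rewrite inE def_f nearC /near /= mi.
  have N1j : inr j \in N1 (f k) by rewrite inE def_f near_refl.
  have vq' : v \in inner (Q j) by rewrite eQ; apply: inner_suffix.
  have sw' c : c < 3 -> forall e, e \in w c -> exists2 z, z \in N1 (f k) & e \in arcs z.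
    move=> lt_c e /(sw c lt_c); rewrite !mem_cat => /or3P[] he.
    - by exists (inl i1); rewrite ?N1i.
    - by exists (inl i2); rewrite ?N1i.
    - by exists (inr j).
  case/orP: vis => vis; [exists (v, w, i1, j)|exists (v, w, i2, j)];
    by split; rewrite ?lt_kn ?N1i //; split=> //; rewrite eP visits_prefix.
have far_f k l x y : k < 2 * n -> l < 2 * n -> k != l ->
    x \in N1 (f k) -> y \in N1 (f l) -> ~~ near x y.
  have main k' l' x' y' : k' < l' -> l' < 2 * n ->
      x' \in N1 (f k') -> y' \in N1 (f l') -> ~~ near x' y'.
    move=> lt_kl lt_l; rewrite ![_ \in N1 _]inE => nx ny.
    apply: contra (fN k' l' lt_kl lt_l) => nxy.
    apply/bigcupP; exists y'; last by rewrite inE nearC.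
    by apply/bigcupP; exists x'; rewrite inE.
  move=> lt_k lt_l; rewrite neq_ltn => /orP[lt_kl|lt_lk] nx ny; first exact: main nx ny.
  by rewrite nearC; apply: main ny nx.
have gk k : k < 2 * n -> good k (g k) by move=> lt_k; apply: Hg; rewrite mem_iota.
exists (fun k => (g k).1.1.1), (fun k => (g k).1.1.2), (fun k => (g k).1.2), (fun k => (g k).2).
split.
- move=> k /gk; case: (g k) => [[[v w] i] j] /= [gw sw _ alt].
  split=> // c lt_c e /(sw c lt_c) [[i'|j'] _ /=].
    by move=> /sP ei; exists i' => //; rewrite ei.
  by move=> /sQ ej; exists j' => //; rewrite ej orbT.
- move=> k l c d lt_k lt_l ne lt_c lt_d.
  move: (gk k lt_k) (gk l lt_l).
  case: (g k) => [[[v w] i] j] /= [_ sw _ _]; case: (g l) => [[[v' w'] i'] j'] /= [_ sw' _ _].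
  apply/negP=> /meetsP[e /(sw c lt_c)[z Nz ez] /(sw' d lt_d)[z' Nz' ez']].
  by have /far/negP[] := far_f _ _ _ _ lt_k lt_l ne Nz Nz'; apply/meetsP; exists e.
- move=> k l lt_k lt_l ne; move: (gk k lt_k) (gk l lt_l).
  case: (g k) => [[[v w] i] j] /= [_ _ [Ni Nj] _].
  case: (g l) => [[[v' w'] i'] j'] /= [_ _ [Ni' Nj'] _].
  have := far_f _ _ _ _ lt_k lt_l ne Ni Ni'; have := far_f _ _ _ _ lt_k lt_l ne Nj Nj'.
  by rewrite /near !orbF => nj ni; split; [apply: contra ni|apply: contra nj] => /eqP/val_inj->.
Qed.

(** If each vertex has fewer than [K] gadgets of either kind, then at most [K] of one kind sit at
    [a], and each of [2 * t] choices excludes at most [2 * K] gadgets. So [4 * t * K + K + 1]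
    gadgets of each kind suffice for the greedy choice. *)
Definition crossing_bound (t K : nat) := 2 * (4 * t * K + K + 1) * 27 + 2.

(** Pigeonhole: either some vertex hosts [K] gadgets of one kind, whose walks [w 1] are dropped, or
    gadgets at distinct vertices are selected greedily. In the first case it is recorded on which
    side [u] is interior, since this will show that [u] is new to a block. *)
Lemma crossing (t K : nat) : crossing_bound t K <= m ->
  (exists (v : nat -> vertex D) (w : nat -> nat -> seq (darc D)),
    [/\ forall k, k < 2 * t -> gadget (k < t) a b (v k) (w k) /\ v k != a,
        forall k l, k < 2 * t -> l < 2 * t -> k != l -> v k != v l,
        forall k l i j, k < 2 * t -> l < 2 * t -> k != l -> i < 3 -> j < 3 ->
          ~~ meets (w k i) (w l j) &
        forall k i, k < 2 * t -> i < 3 -> in_family (w k i)]) \/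
  (exists (u : vertex D) (al be : nat -> seq (darc D)) (ip iq : nat -> nat),
    [/\ forall k, k < K -> [/\ walk a (al k) u, walk u (be k) b,
          in_family (al k), in_family (be k) & ip k < m /\ iq k < m],
        forall k l, k < K -> l < K -> k != l ->
          ~~ meets (al k ++ be k) (al l ++ be l) /\ (ip k != ip l /\ iq k != iq l) &
        (forall k, k < K -> u \in inner (Q (iq k)) /\ visits (P (ip k)) u) \/
        (forall k, k < K -> u \in inner (P (ip k)) /\ visits (Q (iq k)) u)]).
Proof.
set n := 4 * t * K + K + 1 => le_m.
have [v [w [ip [iq [Hk Hw Hi]]]]] := many_gadgets le_m.
have n0 : 0 < 2 * n by rewrite /n; lia.
pose I := 'I_(2 * n).
pose host (c : bool) u : {set I} := [set k : I | ((k < n) == c) && (v k == u)].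
have hosted c u : K <= #|host c u| -> exists al be jp jq,
    [/\ forall k, k < K -> [/\ walk a (al k) u, walk u (be k) b,
          in_family (al k), in_family (be k) & jp k < m /\ jq k < m],
        forall k l, k < K -> l < K -> k != l ->
          ~~ meets (al k ++ be k) (al l ++ be l) /\ (jp k != jp l /\ jq k != jq l) &
        forall k, k < K -> if c then u \in inner (Q (jq k)) /\ visits (P (jp k)) u
          else u \in inner (P (jp k)) /\ visits (Q (jq k)) u].
  move=> /(pick_many (Ordinal n0)) [g [gh gi]].
  have gv k : k < K -> (g k < n) = c /\ v (g k) = u.
    by move=> /gh; rewrite inE => /andP[/eqP-> /eqP->].
  exists (fun k => w (g k) 0), (fun k => w (g k) 2), (fun k => ip (g k)), (fun k => iq (g k)).
  split=> [k lt_k|k l lt_k lt_l ne|k lt_k].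
  - have [gc gu] := gv k lt_k; have [[w0 w2 _ _] sw lt_m _] := Hk (g k) (ltn_ord _).
    by rewrite -gu; split=> //; apply: sw.
  - have ne_g : (g k : nat) != g l by apply: contra ne => /eqP/val_inj/gi->.
    have dd := Hw _ _ _ _ (ltn_ord (g k)) (ltn_ord (g l)) ne_g; split; last exact: Hi.
    apply/negP=> /meetsP[e]; rewrite !mem_cat => /orP[] e1 /orP[] e2.
    + by have /negP[] := dd 0 0 isT isT; apply/meetsP; exists e.
    + by have /negP[] := dd 0 2 isT isT; apply/meetsP; exists e.
    + by have /negP[] := dd 2 0 isT isT; apply/meetsP; exists e.
    + by have /negP[] := dd 2 2 isT isT; apply/meetsP; exists e.
  - by have [<- <-] := gv k lt_k; have [] := Hk (g k) (ltn_ord _).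
have [/existsP[u /hosted]|] := boolP [exists u, K <= #|host true u|].
  by move=> [al [be [jp [jq [H1 H2 H3]]]]]; right; exists u, al, be, jp, jq; split=> //; left.
rewrite negb_exists => /forallP few1.
have [/existsP[u /hosted]|] := boolP [exists u, K <= #|host false u|].
  by move=> [al [be [jp [jq [H1 H2 H3]]]]]; right; exists u, al, be, jp, jq; split=> //; right.
rewrite negb_exists => /forallP few2; left.
have few c u : #|host c u| <= K.
  by case: c; apply: ltnW; rewrite ltnNge.
have card_half c : n <= #|[set k : I | (k < n) == c]|.
  have lt_i (i : 'I_n) : (if c then i : nat else n + i) < 2 * n.
    by have := ltn_ord i; case: (c); lia.
  have inj : injective (fun i => Ordinal (lt_i i)).
    by move=> i i' /(congr1 val) /=; case: (c) => [|/addnI] /val_inj.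
  rewrite -{1}(card_ord n) -(card_imset _ inj); apply: subset_leq_card.
  apply/subsetP=> _ /imsetP[i _ ->]; rewrite inE /=.
  by have := ltn_ord i; case: (c); lia.
have [||k lt_k|f [fS fN]] := @rainbow I (fun k => [set l : I | v l == v k]) (2 * K) (2 * t)
    (fun k => [set l : I | ((l < n) == (k < t)) && (v l != a)]).
- by constructor; apply: Ordinal n0.
- move=> k; apply: leq_trans (_ : #|host true (v k) :|: host false (v k)| <= _).
    by apply: subset_leq_card; apply/subsetP=> l; rewrite !inE => ->; case: (l < n).
  by rewrite (leq_trans (leq_card_setU _ _)) // [leqRHS]mul2n -[leqRHS]addnn leq_add.
- have := card_half (k < t); rewrite -(cardsID [set l : I | v l == a]) => le_n.
  have le_K : #|[set l : I | (l < n) == (k < t)] :&: [set l : I | v l == a]| <= K.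
    by apply: leq_trans (few (k < t) a); apply: subset_leq_card; apply/subsetP=> l; rewrite !inE.
  apply: leq_trans (_ : #|[set l : I | (l < n) == (k < t)] :\: [set l : I | v l == a]| <= _).
    have def_n : n = 4 * t * K + K + 1 by [].
    set A := #|_ :&: _| in le_n le_K; set B := #|_ :\: _| in le_n *.
    by clearbody A B n; nia.
  by apply: subset_leq_card; apply/subsetP=> l; rewrite !inE andbC.
have fI k l : k < 2 * t -> l < 2 * t -> k != l -> v (f k) != v (f l).
  move=> lt_k lt_l; rewrite neq_ltn => /orP[lt|lt].
    by have := fN _ _ lt lt_l; rewrite inE eq_sym.
  by have := fN _ _ lt lt_k; rewrite inE.
exists (fun k => v (f k)), (fun k => w (f k)); split=> //.
- move=> k /fS; rewrite inE => /andP[/eqP<- ->].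
  by have [] := Hk (f k) (ltn_ord _).
- move=> k l i j lt_k lt_l ne; apply: Hw => //.
  by apply: contra (fI k l lt_k lt_l ne) => /eqP->.
- by move=> k i lt_k; have [_ sw _ _] := Hk (f k) (ltn_ord _); apply: sw.
Qed.

End Crossing.

(** * Blocks and immersions *)

Section Rich.
Variable D : digraph.
Implicit Types (a b c u v : vertex D) (B : {set vertex D}) (S : {set darc D}).

Definition conn S a b := exists2 p, walk a p b & {subset p <= S}.

Lemma conn_refl S a : conn S a a.
Proof. by exists [::] => /=. Qed.

Lemma conn_trans S b a c : conn S a b -> conn S b c -> conn S a c.
Proof.
move=> [p wp sp] [q wq sq]; exists (p ++ q); first exact: walk_cat wp wq.
by move=> e; rewrite mem_cat => /orP[/sp|/sq].
Qed.

(** Connecting walks may leave [B], and disjointness concerns arcs only; this leaves freedom to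
    enlarge [B]. *)
Definition rich B K := exists s : nat -> {set darc D},
  (forall k b b', k < K -> b \in B -> b' \in B -> conn (s k) b b') /\
  (forall k l e, k < K -> l < K -> e \in s k -> e \in s l -> k = l).

Lemma rich_leq B K K' : K <= K' -> rich B K' -> rich B K.
Proof.
move=> leK [s [cs ds]]; exists s; split=> [k b b' lt_k|k l e lt_k lt_l].
  exact: cs (leq_trans lt_k leK).
exact: ds (leq_trans lt_k leK) (leq_trans lt_l leK).
Qed.

Lemma rich_set1 x K : rich [set x] K.
Proof.
exists (fun=> set0); split=> [k b b' _|k l e _ _]; last by rewrite inE.
by rewrite !inE => /eqP-> /eqP->; apply: conn_refl.
Qed.

Lemma visits_split a p b u :
  walk a p b -> visits p u -> exists p1 p2, [/\ p = p1 ++ p2, walk a p1 u & walk u p2 b].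
Proof.
elim: p a => //= e p IHp a /andP[/eqP ea wp].
case/orP=> [/orP[/eqP<-|/eqP<-]|vp].
- by exists [::], (e :: p); rewrite /= ea eqxx.
- by exists [:: e], p; rewrite /= ea !eqxx.
have [p1 [p2 [-> w1 w2]]] := IHp _ wp vp.
by exists (e :: p1), p2; rewrite /= ea eqxx.
Qed.

End Rich.

(** Walks shorten to paths on some of their arcs, and since arcs of [H] have distinct ends, none
    becomes empty. *)
Lemma walks_immersion (D H : digraph) (piV : vertex H -> vertex D)
    (piA : darc H -> seq (darc D)) :
    injective piV -> (forall e, walk (piV (dtail e)) (piA e) (piV (dhead e))) ->
    (forall e e', e != e' -> ~~ meets (piA e) (piA e')) ->
  contains_immersion D H.
Proof.
move=> injV wA dA.
have [e _|f Hf] := @seq_choice _ _ [::] (enum (darc H)) (fun e q =>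
    [/\ walk (piV (dtail e)) q (piV (dhead e)), uniq q & {subset q <= piA e}]).
  exact: walk_uniq.
exists piV, f; split=> // [e|e e' ne].
  have [|wf uf _] := Hf e; first by rewrite mem_enum.
  by apply: walk_dipath => //; rewrite (inj_eq injV) dloopless.
have [|_ _ sf] := Hf e; first by rewrite mem_enum.
have [|_ _ sf'] := Hf e'; first by rewrite mem_enum.
rewrite disjoint_has; apply: contra (dA e e' ne); exact: meetsW sf sf'.
Qed.

(** Each arc of [H] is routed in an arc set of its own. *)
Lemma rich_immersion (D H : digraph) (b0 : vertex D) (B : {set vertex D}) (K : nat) :
    rich B K -> #|vertex H| <= #|B| -> #|darc H| <= K ->
  contains_immersion D H.
Proof.
move=> [s [cs ds]] leV leA.
pose piV (v : vertex H) := nth b0 (enum B) (enum_rank v).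
have lt_rank (v : vertex H) : enum_rank v < size (enum B).
  by rewrite -cardE (leq_trans (ltn_ord _)).
have BV v : piV v \in B by rewrite -mem_enum mem_nth.
have injV : injective piV.
  move=> v v' /eqP; rewrite nth_uniq ?enum_uniq // => /eqP/val_inj.
  exact: enum_rank_inj.
have lt_e (e : darc H) : enum_rank e < K by apply: leq_trans (ltn_ord _) leA.
have [e _|f Hf] := @seq_choice _ _ [::] (enum (darc H)) (fun e q =>
    walk (piV (dtail e)) q (piV (dhead e)) /\ {subset q <= s (enum_rank e)}).
  by have [p wp sp] := cs _ _ _ (lt_e e) (BV (dtail e)) (BV (dhead e)); exists p.
apply: (walks_immersion injV (piA := f)) => [e|e e' ne].
  by have [|//] := Hf e; rewrite mem_enum.
have [|_ sf] := Hf e; first by rewrite mem_enum.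
have [|_ sf'] := Hf e'; first by rewrite mem_enum.
apply/negP=> /meetsP[x /sf xe /sf' xe'].
by case/eqP: ne; apply: enum_rank_inj; apply: val_inj; apply: ds xe xe'.
Qed.

Lemma card_onion_vertex t : #|{: onion_vertex t}| <= 2 * t + 1.
Proof.
apply: leq_trans (leq_card _ (can_inj (@onion_vertex_codeK t))) _.
by rewrite card_option card_sum card_ord; lia.
Qed.

Lemma card_onion_arc t : #|{: onion_arc t}| <= 6 * t.
Proof.
apply: leq_trans (leq_card _ (can_inj (@onion_arc_codeK t))) _.
by rewrite !card_sum !card_prod card_bool card_ord; lia.
Qed.

(** The centre is [a]; merging gadgets supply the [y_i] and splitting gadgets the [z_i]. A walk that
    ends at [b] continues along a return walk. There is one such walk for each [y_i] and there are
    two for each [z_i], hence [3 * t] return walks. *)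
Lemma gadgets_immersion (D : digraph) (a b : vertex D) (t : nat)
    (v : nat -> vertex D) (w : nat -> nat -> seq (darc D)) (back : nat -> seq (darc D)) :
    (forall k, k < 2 * t -> gadget (k < t) a b (v k) (w k) /\ v k != a) ->
    (forall k l, k < 2 * t -> l < 2 * t -> k != l -> v k != v l) ->
    (forall k l i j, k < 2 * t -> l < 2 * t -> k != l -> i < 3 -> j < 3 ->
      ~~ meets (w k i) (w l j)) ->
    (forall k, k < 3 * t -> walk b (back k) a) ->
    (forall k l, k < 3 * t -> l < 3 * t -> k != l -> ~~ meets (back k) (back l)) ->
    (forall k i l, k < 2 * t -> i < 3 -> l < 3 * t -> ~~ meets (w k i) (back l)) ->
  contains_immersion D (onion_star t).
Proof.
move=> Hg Hv Hw wb db dwb.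
pose piV (x : onion_vertex t) := match x with
  | OX => a | OY i => v i | OZ i => v (t + i) end.
(* The gadget index, the walk in it, and the return walk, if any, of an arc. *)
pose code (e : onion_arc t) : nat * nat * option nat := match e with
  | AYX i => (i : nat, 2, Some (i : nat))
  | AXZ i => (t + i, 0, None)
  | AXY i c => (i : nat, c : nat, None)
  | AZX i c => (t + i, c.+1, Some (t + 2 * i + c)) end.
pose piA e := let '(k, i, l) := code e in
  w k i ++ (if l is Some l' then back l' else [::]).
have lt1 (i : 'I_t) : i < 2 * t by have := ltn_ord i; lia.
have lt2 (i : 'I_t) : t + i < 2 * t by have := ltn_ord i; lia.
have nlt (i : 'I_t) : (t + i < t) = false by lia.
have lt_code e : [/\ (code e).1.1 < 2 * t, (code e).1.2 < 3 &
    forall l, (code e).2 = Some l -> l < 3 * t].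
  case: e => [i|i|i c|i c] /=; split=> //; try by case: (c).
  - by move=> _ [<-]; have := ltn_ord i; lia.
  - by move=> _ [<-]; have := ltn_ord i; case: (c); lia.
have dg e e' : e != e' -> ~~ meets (w (code e).1.1 (code e).1.2) (w (code e').1.1 (code e').1.2).
  move=> ne; have [l1 l2 _] := lt_code e; have [l1' l2' _] := lt_code e'.
  have [eq_k|ne_k] := eqVneq (code e).1.1 (code e').1.1; last exact: Hw.
  have [[_ _ _ dk] _] := Hg _ l1.
  have [eq_i|] := eqVneq (code e).1.2 (code e').1.2.
    case/eqP: ne; move: eq_k eq_i; clear.
    case: e => [i|i|i c|i c]; case: e' => [j|j|j d|j d] /=;
      have := ltn_ord i; have := ltn_ord j;
      try case: c; try case: d; move=> lt_i lt_j; try lia;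
      by [move=> /val_inj->|move=> /addnI/val_inj->].
  rewrite -eq_k neq_ltn => /orP[lt|lt]; first exact: dk.
  by rewrite meetsC; apply: dk.
have db' e e' l l' : e != e' -> (code e).2 = Some l -> (code e').2 = Some l' -> l != l'.
  case: e => [i|i|i c|i c]; case: e' => [j|j|j d|j d] //= ne [<-] [<-];
    have := ltn_ord i; have := ltn_ord j; try lia.
  - by move=> _ _; apply: contra ne => /eqP/val_inj->.
  - move=> _ _; apply: contra ne => /eqP eq_l.
    have eq_ij : i = j by apply: val_inj; move: eq_l; case: (c); case: (d) => /=; lia.
    have -> : c = d by move: eq_l; rewrite eq_ij; case: (c); case: (d) => /=; lia.
    by rewrite eq_ij.
apply: (@walks_immersion D (onion_star t) piV piA).
- have na k : k < 2 * t -> (v k == a) = false by move=> /Hg[_ /negPf].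
  case=> [|i|i]; case=> [|j|j] //= /eqP; rewrite ?na // 1?eq_sym ?na //.
  + by case: (eqVneq (i : nat) j) => [/val_inj->//|/Hv-/(_ (lt1 i) (lt1 j))/negPf]; rewrite eq_sym => ->.
  + have ne : (i : nat) != t + j by have := ltn_ord i; lia.
    by rewrite eq_sym (negPf (Hv _ _ (lt1 i) (lt2 j) ne)).
  + have ne : t + i != j by have := ltn_ord j; lia.
    by rewrite eq_sym (negPf (Hv _ _ (lt2 i) (lt1 j) ne)).
  + have [/val_inj->//|ne] := eqVneq (i : nat) j.
    by rewrite eq_sym (negPf (Hv _ _ (lt2 i) (lt2 j) _)) // eqn_add2l.
- move=> e; have [_ _ lt_l] := lt_code e; case: e lt_l => [i|i|i c|i c] lt_l; rewrite /piA /=.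
  + have [[_ w2 _ _] _] := Hg _ (lt1 i); apply: walk_cat w2 (wb _ _).
    exact: lt_l.
  + by have [[w0 _ _ _] _] := Hg _ (lt2 i); rewrite cats0.
  + by have [[w0 _]] := Hg _ (lt1 i); rewrite ltn_ord cats0 => w1 _ _; case: (c).
  + have [[_ w2]] := Hg _ (lt2 i); rewrite nlt => w1 _ _.
    by apply: walk_cat (wb _ (lt_l _ erefl)); case: (c).
- move=> e e' ne; rewrite /piA.
  have := dg _ _ ne; have := db' e e'; have := lt_code e; have := lt_code e'.
  case: (code e) => [[k i] l]; case: (code e') => [[k' i'] l'] /= [lk' li' ll'] [lk li ll] dl dk.
  apply/negP=> /meetsP[x]; rewrite !mem_cat => /orP[] x1 /orP[] x2.
  + by case/negP: dk; apply/meetsP; exists x.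
  + case: l' ll' {dl} x2 => // l' /(_ _ erefl) lt_l' x2.
    by have /negP[] := dwb _ _ _ lk li lt_l'; apply/meetsP; exists x.
  + case: l ll {dl} x1 => // l /(_ _ erefl) lt_l x1.
    by have /negP[] := dwb _ _ _ lk' li' lt_l; apply/meetsP; exists x.
  + case: l ll dl x1 => // l /(_ _ erefl) lt_l dl x1.
    case: l' ll' dl x2 => // l' /(_ _ erefl) lt_l' dl x2.
    by have /negP[] := db _ _ lt_l lt_l' (dl _ _ ne erefl erefl); apply/meetsP; exists x.
Qed.

(** * Shortest crossing cycles *)

Section Routes.
Variables (V O : eqType) (tl hd : O -> V).
Implicit Types (r : seq O).

(** Walks one level up: in the application an arc is a whole family of walks with common ends. *)
Fixpoint route b r a : bool :=
  if r is o :: r' then (tl o == b) && route (hd o) r' a else b == a.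

Lemma route_catP b r r' a :
  reflect (exists2 c, route b r c & route c r' a) (route b (r ++ r') a).
Proof.
elim: r b => [|o r IHr] b /=.
  by apply: (iffP idP) => [wr|[c /eqP-> //]]; exists b.
apply: (iffP andP) => [[-> /IHr[c wp wq]]|[c /andP[-> wp] wq]]; first by exists c.
by split=> //; apply/IHr; exists c.
Qed.

Lemma route_prefix b r1 o r2 a : route b (r1 ++ o :: r2) a -> route b r1 (tl o).
Proof. by case/route_catP=> c r1c /= /andP[/eqP-> _]. Qed.

Lemma route_suffix b r1 o r2 a : route b (r1 ++ o :: r2) a -> route (hd o) r2 a.
Proof. by case/route_catP=> c _ /= /andP[]. Qed.

End Routes.

Section Growth.
Variables (D : digraph) (t K m M : nat).
Let V := vertex D.
Variables (X : {set V}) (B : V -> {set V}) (s : V -> nat -> {set darc D}).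

(* A family of walks is a link of the block of [x] if its owner is [Some x], and
   otherwise leads from one block to another. *)
Variables (O : eqType) (owner : O -> option V) (os : seq O) (W : O -> nat -> seq (darc D)) (tl hd : O -> V).

Hypothesis m_ge : [/\ 0 < K, crossing_bound t K <= m, K <= m & 3 * t <= m].
(** Two crossing families use slots below [2 * m], return routes those from [2 * m] on. *)
Hypothesis M_ge : 3 * m <= M.
Hypothesis s_conn : forall x k b b', x \in X -> k < M -> b \in B x -> b' \in B x ->
  conn (s x k) b b'.
Hypothesis s_disj : forall x k l e, x \in X -> k < M -> l < M ->
  e \in s x k -> e \in s x l -> k = l.
Hypothesis W_walk : forall o k, o \in os -> k < M -> walk (tl o) (W o k) (hd o).
Hypothesis W_uniq : forall o k, o \in os -> k < M -> uniq (W o k).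
Hypothesis W_disj : forall o k l, o \in os -> k < M -> l < M -> k != l ->
  ~~ meets (W o k) (W o l).
(** Walks of two families in the same slot may or may not meet, so disjointness is always drawn from
    different slots. *)
Hypothesis W_hom : forall o o' k l, o \in os -> o' \in os -> k < l -> l < M ->
  meets (W o k) (W o' l) = meets (W o 0) (W o' 1).
Hypothesis link_end : forall o x, o \in os -> owner o = Some x ->
  [/\ x \in X, tl o \in B x & hd o \in B x].
Hypothesis link_slot : forall o x k, o \in os -> owner o = Some x -> k < M ->
  {subset W o k <= s x k}.
Hypothesis link_direct : forall o x k u, o \in os -> owner o = Some x -> k < M ->
  u \in inner (W o k) -> u \notin B x.
Hypothesis inter_end : forall o, o \in os -> owner o = None ->
  tl o \in \bigcup_(x in X) B x /\ hd o \in \bigcup_(x in X) B x.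
Hypothesis inter_direct : forall o k u, o \in os -> owner o = None -> k < M ->
  u \in inner (W o k) -> u \notin \bigcup_(x in X) B x.
Hypothesis link_route : forall x b b', x \in X -> b \in B x -> b' \in B x ->
  exists r, [/\ route tl hd b r b', size r < #|V| &
    forall o, o \in r -> o \in os /\ owner o = Some x].

(** [W_hom] depends on the order of the slots, hence both orders. Families that do not cross are
    disjoint in any two different slots. *)
Definition crossing_pair o o' := meets (W o 0) (W o' 1) || meets (W o' 0) (W o 1).

Definition immersion_or_growth :=
  contains_immersion D (onion_star t) \/
  exists x u, [/\ x \in X, u \notin B x & rich (u |: B x) K].

(** The extra 1 on the route makes it a gain to turn a route family into a crossing one. The weight
    [#|V|] makes it a gain to replace a crossing inter-block family by a link, even at the price of
    a detour of fewer than [#|V|] links. *)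
Let half (o : O) := if owner o is Some _ then 0 else #|V|.
Let key F G r := half F + half G + \sum_(o <- r) (half o).+1.

Lemma M_gt1 : 1 < M.
Proof. by case: m_ge; rewrite /crossing_bound; lia. Qed.

Lemma crossing_pairC o o' : crossing_pair o o' = crossing_pair o' o.
Proof. exact: orbC. Qed.

Lemma crossing_pair_irr o : o \in os -> ~~ crossing_pair o o.
Proof. by move=> oo; rewrite /crossing_pair orbb W_disj // ?M_gt1 // ltnW // M_gt1. Qed.

Lemma noncrossing o o' k l : o \in os -> o' \in os -> ~~ crossing_pair o o' ->
  k < M -> l < M -> k != l -> ~~ meets (W o k) (W o' l).
Proof.
move=> oo oo'; rewrite negb_or => /andP[n1 n2] lt_k lt_l.
rewrite neq_ltn => /orP[lt|lt]; first by rewrite W_hom.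
by rewrite meetsC W_hom.
Qed.

(** Links of one block run in its slots [s x k], which are disjoint for different [k]. *)
Lemma link_noncrossing o o' x : o \in os -> o' \in os ->
  owner o = Some x -> owner o' = Some x -> ~~ crossing_pair o o'.
Proof.
move=> oo oo' ox ox'; have [xX _ _] := link_end oo ox; have M1 := M_gt1.
have M0 : 0 < M by apply: ltnW.
rewrite negb_or; apply/andP; split; apply/negP=> /meetsP[e e1 e2].
  by have := s_disj xX M0 M1 (link_slot oo ox M0 e1) (link_slot oo' ox' M1 e2).
by have := s_disj xX M0 M1 (link_slot oo' ox' M0 e1) (link_slot oo ox M1 e2).
Qed.

Lemma route_walk b r a k : {subset r <= os} -> route tl hd b r a -> k < M ->
  walk b (flatten [seq W o k | o <- r]) a.
Proof.
elim: r b => //= o r IHr b sr /andP[/eqP<- wr] lt_k.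
apply: walk_cat (W_walk (sr _ (mem_head _ _)) lt_k) _.
by apply: IHr => // o' o'r; apply: sr; rewrite inE o'r orbT.
Qed.

(** A link through [u] starts and ends in the block, so the slot containing it joins [u] to the
    block in both directions. *)
Lemma link_growth o x u (i : nat -> nat) : o \in os -> owner o = Some x -> u \notin B x ->
    (forall k, k < K -> i k < M /\ visits (W o (i k)) u) ->
    (forall k l, k < K -> l < K -> k != l -> i k != i l) ->
  immersion_or_growth.
Proof.
move=> oo ox uB vis inj; have [xX tB hB] := link_end oo ox.
right; exists x, u; split=> //; exists (fun k => s x (i k)); split=> [k b b' lt_k|k l e lt_k lt_l].
  have [lt_i vu] := vis k lt_k.
  suff hub (c : vertex D) : c \in u |: B x -> conn (s x (i k)) c (tl o) /\ conn (s x (i k)) (tl o) c.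
    by move=> /hub[c1 _] /hub[_ c2]; apply: conn_trans c1 c2.
  rewrite !inE => /orP[/eqP->|cB]; last by split; apply: s_conn.
  have [p1 [p2 [eq_p w1 w2]]] := visits_split (W_walk oo lt_i) vu.
  have sub := link_slot oo ox lt_i.
  split.
    apply: conn_trans (_ : conn _ u (hd o)) (s_conn xX lt_i hB tB).
    by exists p2 => // e e2; apply: sub; rewrite eq_p mem_cat e2 orbT.
  by exists p1 => // e e1; apply: sub; rewrite eq_p mem_cat e1.
have [lt_ik _] := vis k lt_k; have [lt_il _] := vis l lt_l.
move=> e1 e2; apply/eqP/negPn/negP => ne.
by have := inj k l lt_k lt_l ne; rewrite (s_disj xX lt_ik lt_il e1 e2) eqxx.
Qed.

(** One family takes the first [m] slots and the other the next [m], in the order in which they are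
    known to meet. *)
Lemma oriented_pair F G : F \in os -> G \in os -> crossing_pair F G ->
  exists iF iG, [/\ iF + m <= 2 * m, iG + m <= 2 * m &
    forall i j, i < m -> j < m -> meets (W F (iF + i)) (W G (iG + j))].
Proof.
move=> oF oG /orP[mFG|mGF]; [exists 0, m|exists m, 0]; (split; first lia; first lia) => i j lt_i lt_j.
  by rewrite W_hom //; lia.
by rewrite meetsC W_hom //; lia.
Qed.

Lemma has_crossing_split (r : seq O) : {subset r <= os} ->
    has (fun o => has (crossing_pair o) r) r ->
  exists r1 o r2 o' r3, r = r1 ++ o :: r2 ++ o' :: r3 /\ crossing_pair o' o.
Proof.
move=> sr /hasP[o or /hasP[o' o'r cr]].
have ne : o' != o.
  by apply: contraL cr => /eqP->; apply: crossing_pair_irr; apply: sr.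
case/splitPr: or o'r {sr} => r1 r2; rewrite mem_cat inE (negPf ne) /= => /orP[] o'r.
  case/splitPr: o'r => r3 r4; exists r3, o', r4, o, r2.
  by rewrite -catA cat_cons.
by case/splitPr: o'r => r3 r4; exists r1, o, r3, o', r4; rewrite crossing_pairC.
Qed.

(* The members of [F] and [G] meet and the route leads back from the end of [G]
   to the start of [F].  Any further crossing along this cycle, or of this
   cycle with the links of the block at the end of [G], is the base of a cycle
   with a smaller key.  Counting inter-block families half when they are one of
   the two crossing families makes both kinds of shortcut decrease the key. *)
Lemma crossing_cycle F G r : F \in os -> G \in os -> crossing_pair F G ->
  {subset r <= os} -> route tl hd (hd G) r (tl F) -> immersion_or_growth.
Proof.
have [n] := ubnP (key F G r); elim: n => // n IHn in F G r *.
rewrite ltnS => le_n oF oG cFG sr wr.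
have IH F' G' r' : key F' G' r' < key F G r -> F' \in os -> G' \in os ->
    crossing_pair F' G' -> {subset r' <= os} -> route tl hd (hd G') r' (tl F') ->
    immersion_or_growth.
  by move=> lt_k; apply: IHn; apply: leq_trans lt_k le_n.
have sum_split r1 o r2 : \sum_(o <- r1 ++ o :: r2) (half o).+1 =
    \sum_(o <- r1) (half o).+1 + ((half o).+1 + \sum_(o <- r2) (half o).+1).
  by rewrite big_cat big_cons.
(* A route family that crosses [F] closes a shorter cycle with the rest of the route. The next two
   cases treat crossings with [G] and within the route alike. *)
have [/hasP[o or cr]|ncF] := boolP (has (crossing_pair F) r).
  case/splitPr: or sr wr IH => r1 r2 sr wr IH.
  apply: (IH F o r2) => //.
  - by rewrite /key sum_split; clear; lia.
  - by apply: sr; rewrite mem_cat mem_head orbT.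
  - by move=> o' o'r; apply: sr; rewrite mem_cat inE o'r !orbT.
  - exact: route_suffix wr.
have [/hasP[o or cr]|ncG] := boolP (has (crossing_pair G) r).
  case/splitPr: or sr wr IH => r1 r2 sr wr IH.
  apply: (IH o G r1) => //.
  - by rewrite /key sum_split; clear; lia.
  - by apply: sr; rewrite mem_cat mem_head orbT.
  - by rewrite crossing_pairC.
  - by move=> o' o'r; apply: sr; rewrite mem_cat o'r.
  - exact: route_prefix wr.
have [|ncr] := boolP (has (fun o => has (crossing_pair o) r) r).
  case/has_crossing_split=> // r1 [o [r2 [o' [r3 [def_r cr]]]]].
  rewrite def_r in sr wr IH.
  apply: (IH o' o r2) => //.
  - by rewrite /key !sum_split; clear; lia.
  - by apply: sr; rewrite !(mem_cat, inE) eqxx !orbT.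
  - by apply: sr; rewrite !(mem_cat, inE) eqxx !orbT.
  - by move=> x xr; apply: sr; rewrite !(mem_cat, inE) xr !orbT.
  - by apply: route_prefix (route_suffix wr).
have {ncr} nc_r o o' : o \in r -> o' \in r -> ~~ crossing_pair o o'.
  by move=> or o'r; apply: contra ncr => cr; apply/hasP; exists o => //; apply/hasP; exists o'.
have {ncF} nc_F o : o \in r -> ~~ crossing_pair F o by apply/hasPn.
have {ncG} nc_G o : o \in r -> ~~ crossing_pair G o by apply/hasPn.
have [K_gt0 le_m leK le3] := m_ge.
have [iF [iG [le_iF le_iG mFG]]] := oriented_pair oF oG cFG.
have slotM k : k < m -> 2 * m + k < M by move: M_ge; clear; lia.
have M_F i : i < m -> iF + i < M by move: M_ge le_iF; clear; lia.
have M_G i : i < m -> iG + i < M by move: M_ge le_iG; clear; lia.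
have ne_F i k : i < m -> iF + i != 2 * m + k by move: le_iF; clear; lia.
have ne_G i k : i < m -> iG + i != 2 * m + k by move: le_iG; clear; lia.
have lt_m k : k < 3 * t -> k < m by move/leq_trans; apply.
have leKm k : k < K -> k < m by move/leq_trans; apply.
(* Each return walk has a slot of its own, used by neither [F] nor [G]. *)
pose back k := flatten [seq W o (2 * m + k) | o <- r].
have far_slots o i k e : o \in os -> ~~ crossing_pair F o -> ~~ crossing_pair G o ->
    i < m -> k < m -> (e \in W F (iF + i)) || (e \in W G (iG + i)) -> e \in W o (2 * m + k) -> False.
  move=> oo cF cG lt_i lt_k eFG eo.
  case/orP: eFG => e1.
    have /negP[] : ~~ meets (W F (iF + i)) (W o (2 * m + k)).
      by apply: noncrossing; rewrite ?M_F ?slotM ?ne_F.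
    by apply/meetsP; exists e.
  have /negP[] : ~~ meets (W G (iG + i)) (W o (2 * m + k)).
    by apply: noncrossing; rewrite ?M_G ?slotM ?ne_G.
  by apply/meetsP; exists e.
have backP e k : e \in back k -> exists2 o, o \in r & e \in W o (2 * m + k).
  by move=> /flatten_mapP[o or eo]; exists o.
have w_back k : k < m -> walk (hd G) (back k) (tl F).
  by move=> lt_k; apply: route_walk; rewrite ?slotM.
have [|||||||[v [w [Hg Hv Hw Hf]]]|[u [al [be [ip [iq [Hk Hd Hu]]]]]]] :=
    @crossing D (tl F) (hd G) m (fun i => W F (iF + i)) (fun i => W G (iG + i)) _ _ _ _ _ _ _ t K le_m.
- by move=> i /M_F lt_i; exists (hd F); apply: W_walk.
- by move=> i /M_G lt_i; exists (tl G); apply: W_walk.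
- by move=> i /M_F lt_i; apply: W_uniq.
- by move=> i /M_G lt_i; apply: W_uniq.
- by move=> i j /M_F lt_i /M_F lt_j ne; apply: W_disj; rewrite ?eqn_add2l.
- by move=> i j /M_G lt_i /M_G lt_j ne; apply: W_disj; rewrite ?eqn_add2l.
- exact: mFG.
- left; apply: (gadgets_immersion Hg Hv Hw (back := back)).
  + by move=> k lt_k; apply/w_back/lt_m.
  + move=> k l lt_k lt_l ne; apply/negP=> /meetsP[e /backP[o or eo] /backP[o' or' eo']].
    have /negP[] : ~~ meets (W o (2 * m + k)) (W o' (2 * m + l)).
      by apply: noncrossing; rewrite ?sr ?nc_r ?eqn_add2l ?slotM ?lt_m.
    by apply/meetsP; exists e.
  + move=> k i l lt_k lt_i lt_l; apply/negP=> /meetsP[e /(Hf k i lt_k lt_i)[j lt_j ej] /backP[o or eo]].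
    exact: far_slots (sr _ or) (nc_F _ or) (nc_G _ or) lt_j (lt_m _ lt_l) ej eo.
have visF k : k < K -> visits (W F (iF + ip k)) u.
  by case: Hu => Hu /Hu[] // /inner_visits.
have visG k : k < K -> visits (W G (iG + iq k)) u.
  by case: Hu => Hu /Hu[] // /inner_visits.
have growF x : owner F = Some x -> u \notin B x -> immersion_or_growth.
  move=> Fx uB; apply: (link_growth oF Fx uB (i := fun k => iF + ip k)) => [k lt_k|k l lt_k lt_l ne].
    by have [_ _ _ _ [/M_F lt_i _]] := Hk k lt_k; split; last exact: visF.
  by have [_ [ne_i _]] := Hd k l lt_k lt_l ne; rewrite eqn_add2l.
have growG x : owner G = Some x -> u \notin B x -> immersion_or_growth.
  move=> Gx uB; apply: (link_growth oG Gx uB (i := fun k => iG + iq k)) => [k lt_k|k l lt_k lt_l ne].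
    by have [_ _ _ _ [_ /M_G lt_i]] := Hk k lt_k; split; last exact: visG.
  by have [_ [_ ne_i]] := Hd k l lt_k lt_l ne; rewrite eqn_add2l.
(* Here [u] joins the block of [x] that contains [hd G]. First, no link of this block crosses [F],
   [G] or the route, since otherwise a detour inside the block yields a smaller key. *)
have composite : owner F = None -> owner G = None -> u \notin \bigcup_(x in X) B x ->
    immersion_or_growth.
  move=> Fi Gi uS; have hF : half F = #|V| by rewrite /half Fi.
  have hG : half G = #|V| by rewrite /half Gi.
  have [_ /bigcupP[x xX GB]] := inter_end oG Gi.
  pose ls := [seq o <- os | owner o == Some x].
  have lsP o : o \in ls -> o \in os /\ owner o = Some x.
    by rewrite mem_filter => /andP[/eqP].
  have sum_links r' : (forall o, o \in r' -> o \in os /\ owner o = Some x) ->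
      \sum_(o <- r') (half o).+1 = size r'.
    move=> lr'; rewrite -sum1_size big_seq [RHS]big_seq; apply: eq_bigr => o /lr'[_ ox].
    by rewrite /half ox.
  have half_link o : o \in ls -> half o = 0 by move=> /lsP[_ ox]; rewrite /half ox.
  have [/hasP[o or /hasP[l ll cr]]|nc1] := boolP (has (fun o => has (crossing_pair o) ls) r).
    have [lo lx] := lsP l ll; have [_ _ lB] := link_end lo lx.
    have [r' [wr' lt_r' lr']] := link_route xX lB GB.
    case/splitPr: or sr wr IH => r1 r2 sr wr IH.
    apply: (IH o l (r' ++ r1)) => //.
    - by rewrite /key sum_split big_cat /= sum_links // (half_link l) // hF hG; move: lt_r'; clear; lia.
    - by apply: sr; rewrite mem_cat mem_head orbT.
    - move=> y; rewrite mem_cat => /orP[/lr'[]//|yr].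
      by apply: sr; rewrite mem_cat yr.
    - by apply/route_catP; exists (hd G) => //; apply: route_prefix wr.
  have [/hasP[l ll cr]|nc2] := boolP (has (crossing_pair F) ls).
    have [lo lx] := lsP l ll; have [_ _ lB] := link_end lo lx.
    have [r' [wr' lt_r' lr']] := link_route xX lB GB.
    apply: (IH F l (r' ++ r)) => //.
    - by rewrite /key big_cat /= sum_links // (half_link l) // hF hG; move: lt_r'; clear; lia.
    - by move=> y; rewrite mem_cat => /orP[/lr'[]//|]; apply: sr.
    - by apply/route_catP; exists (hd G).
  have [/hasP[l ll cr]|nc3] := boolP (has (crossing_pair G) ls).
    have [lo lx] := lsP l ll; have [_ lB _] := link_end lo lx.
    have [r' [wr' lt_r' lr']] := link_route xX GB lB.
    apply: (IH l G r') => //.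
    - by rewrite /key sum_links // (half_link l) // hF hG; move: lt_r'; clear; lia.
    - by rewrite crossing_pairC.
    - by move=> y /lr'[].
  have sls : {subset ls ++ r <= os}.
    by move=> o; rewrite mem_cat => /orP[/lsP[]//|/sr].
  have nc_rl o l : o \in r -> l \in ls -> ~~ crossing_pair o l.
    by move=> or ll; apply: contra nc1 => cr; apply/hasP; exists o => //; apply/hasP; exists l.
  have nc o o' : o \in ls ++ r -> o' \in ls ++ r -> ~~ crossing_pair o o'.
    rewrite !mem_cat => /orP[ol|or] /orP[ol'|or'].
    - by have [oo ox] := lsP o ol; have [oo' ox'] := lsP o' ol'; apply: link_noncrossing ox ox'.
    - by rewrite crossing_pairC nc_rl.
    - exact: nc_rl.
    - exact: nc_r.
  have ncF o : o \in ls ++ r -> ~~ crossing_pair F o.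
    by rewrite mem_cat => /orP[|/nc_F//]; apply/hasPn.
  have ncG o : o \in ls ++ r -> ~~ crossing_pair G o.
    by rewrite mem_cat => /orP[|/nc_G//]; apply/hasPn.
  (* In the new arc set the links connect the block, [be k] leads from [u] to [hd G], and the route
     followed by [al k] leads back to [u]. *)
  pose T k := [set e in flatten [seq W o (2 * m + k) | o <- ls ++ r] ++ al k ++ be k].
  right; exists x, u; split=> //; first by apply: contra uS => uB; apply/bigcupP; exists x.
  exists T; split=> [k b b' lt_k|k l e lt_k lt_l].
    have lt_M : 2 * m + k < M by apply/slotM/leKm.
    have sub o : o \in ls ++ r -> {subset W o (2 * m + k) <= T k}.
      move=> os_o e eo; rewrite inE mem_cat; apply/orP; left.
      by apply/flatten_mapP; exists o.
    have via r' c c' : route tl hd c r' c' -> {subset r' <= ls ++ r} -> conn (T k) c c'.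
      move=> wr' sr'; exists (flatten [seq W o (2 * m + k) | o <- r']).
        by apply: route_walk => // o /sr'/sls.
      by move=> e /flatten_mapP[o /sr' os_o]; apply: sub.
    have [wa wb _ _ _] := Hk k lt_k.
    suff hub c : c \in u |: B x -> conn (T k) c (hd G) /\ conn (T k) (hd G) c.
      by move=> /hub[c1 _] /hub[_ c2]; apply: conn_trans c1 c2.
    rewrite !inE => /orP[/eqP->|cB].
      split; first by exists (be k) => // e eb; rewrite inE !mem_cat eb !orbT.
      apply: conn_trans (via r _ _ wr _) _.
        by move=> o or; rewrite mem_cat or orbT.
      by exists (al k) => // e ea; rewrite inE !mem_cat ea !orbT.
    have [r1 [w1 _ l1]] := link_route xX cB GB.
    have [r2 [w2 _ l2]] := link_route xX GB cB.
    split; [apply: via w1 _|apply: via w2 _] => o.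
      by move=> /l1[oo ox]; rewrite mem_cat mem_filter oo ox eqxx.
    by move=> /l2[oo ox]; rewrite mem_cat mem_filter oo ox eqxx.
  have fam k' e' : k' < K -> e' \in al k' ++ be k' ->
      exists2 i, i < m & (e' \in W F (iF + i)) || (e' \in W G (iG + i)).
    move=> lt_k'; have [_ _ fa fb _] := Hk k' lt_k'.
    by rewrite mem_cat => /orP[/fa|/fb].
  rewrite !inE ![e \in _ ++ (al _ ++ _)]mem_cat => /orP[/flatten_mapP[o os_o eo]|e1].
    case/orP=> [/flatten_mapP[o' os_o' eo']|/(fam l e lt_l)[i lt_i ei]].
      apply/eqP/negPn/negP => ne.
      have /negP[] : ~~ meets (W o (2 * m + k)) (W o' (2 * m + l)).
        by apply: noncrossing; rewrite ?sls ?nc ?eqn_add2l ?slotM ?leKm.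
      by apply/meetsP; exists e.
    by case: (far_slots o i k e (sls _ os_o) (ncF _ os_o) (ncG _ os_o) lt_i (leKm _ lt_k) ei eo).
  case/orP=> [/flatten_mapP[o os_o eo]|e2].
    have [i lt_i ei] := fam k e lt_k e1.
    by case: (far_slots o i l e (sls _ os_o) (ncF _ os_o) (ncG _ os_o) lt_i (leKm _ lt_l) ei eo).
  apply/eqP/negPn/negP => ne; have [/negP nm _] := Hd k l lt_k lt_l ne.
  by apply: nm; apply/meetsP; exists e.
(* Being interior to the walks of one crossing family, [u] lies outside the block of that family if
   it is a link, and outside all blocks otherwise; in the latter case the other family decides. *)
case: Hu => Hu; have [ui _] := Hu 0 K_gt0; have [_ _ _ _ [/M_F lt_p /M_G lt_q]] := Hk 0 K_gt0.
  case eG: (owner G) => [x|]; first by apply: (growG x) => //; apply: link_direct ui.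
  have uS := inter_direct oG eG lt_q ui.
  case eF: (owner F) => [x|]; last exact: composite.
  apply: (growF x) => //; apply: contra uS => uB; apply/bigcupP; exists x => //.
  by have [] := link_end oF eF.
case eF: (owner F) => [x|]; first by apply: (growF x) => //; apply: link_direct ui.
have uS := inter_direct oF eF lt_p ui.
case eG: (owner G) => [x|]; last exact: composite.
apply: (growG x) => //; apply: contra uS => uB; apply/bigcupP; exists x => //.
by have [] := link_end oG eG.
Qed.

End Growth.

(** * Growing the blocks *)

Section Cuts.
Variables (V : finType) (O : eqType) (tl hd : O -> V).

Definition arrow (os : seq O) : rel V :=
  fun c c' => has (fun o => (tl o == c) && (hd o == c')) os.

Lemma arrowP os o : o \in os -> arrow os (tl o) (hd o).
Proof. by move=> oo; apply/hasP; exists o; rewrite ?eqxx. Qed.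

Lemma connect_arrow_sub os os' : {subset os <= os'} ->
  subrel (connect (arrow os)) (connect (arrow os')).
Proof.
move=> sub; apply: connect_sub => x y /hasP[o /sub oo xy]; apply: connect1.
by apply/hasP; exists o.
Qed.

(** A simple path gives the length bound on which the decrease of [key] rests. *)
Lemma connect_route os b b' : connect (arrow os) b b' ->
  exists r, [/\ route tl hd b r b', size r < #|V| & {subset r <= os}].
Proof.
case/connectP=> p0 path_p0 ->; case/shortenP: path_p0 => p path_p uniq_p _ {p0}.
have lt_p : size p < #|V|.
  by rewrite -[(size p).+1]/(size (b :: p)) -(card_uniqP uniq_p) max_card.
suff [r [wr sz sr]] : exists r, [/\ route tl hd b r (last b p), size r = size p &
    {subset r <= os}] by exists r; rewrite sz.
elim: p b path_p {uniq_p lt_p} => [|c p IHp] b /=; first by exists [::]; rewrite /= eqxx.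
case/andP=> /hasP[o oo /andP[/eqP tb /eqP hc]] /IHp[r [wr sz sr]].
exists (o :: r); rewrite /= tb hc eqxx sz; split=> // x.
by rewrite inE => /orP[/eqP->|/sr].
Qed.

(** Otherwise the part of [S] reachable from [b] would be a cut that no family leaves. *)
Lemma cut_connect os (S : {set V}) :
    (forall A : {set V}, A \subset S -> A != set0 -> A != S ->
      exists o, [/\ o \in os, tl o \in A & hd o \in S :\: A]) ->
  forall b b', b \in S -> b' \in S -> connect (arrow os) b b'.
Proof.
move=> cut b b' bS b'S; apply/negPn/negP => nc.
pose A := [set c in S | connect (arrow os) b c].
have [|||o [oo]] := cut A.
- by apply/subsetP=> c; rewrite inE => /andP[].
- by apply/set0Pn; exists b; rewrite inE bS connect0.
- by apply: contraNneq nc => eA; move: b'S; rewrite -eA inE => /andP[].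
rewrite !inE => /andP[_ bt] /andP[/negP nh hS]; apply: nh; rewrite hS /=.
by apply: connect_trans bt (connect1 (arrowP oo)).
Qed.

End Cuts.

(** Pairwise distinct values would not fit into [S]. *)
Lemma constant_on_homogeneous (T : finType) (S : {set T}) (M : nat) (g : nat -> T) :
    #|S| < M -> (forall k, k < M -> g k \in S) ->
    (forall k l, k < l -> l < M -> g k == g l) \/
    (forall k l, k < l -> l < M -> g k != g l) ->
  forall k, k < M -> g k = g 0.
Proof.
move=> lt_S gS [eq_g [//|k] lt_k|ne_g]; first by apply/eqP; rewrite eq_sym eq_g.
have inj : injective (fun k : 'I_M => g k).
  move=> k l eq_g; apply: val_inj => /=; apply/eqP/negPn/negP; rewrite neq_ltn.
  by case/orP=> lt; have := ne_g _ _ lt (ltn_ord _); rewrite eq_g eqxx.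
suff : M <= #|S| by rewrite leqNgt lt_S.
rewrite -(card_ord M) -(card_imset _ inj); apply: subset_leq_card.
by apply/subsetP=> _ /imsetP[k _ ->]; apply: gS.
Qed.

(** * Walks without interior vertices in given sets *)

Section DirectWalks.
Variables (D : digraph) (U U' : {set vertex D}).

(** At an interior vertex in [U] the part after it is kept, at one in [U'] the part before it. The
    ends may thus move within [U] and [U']. *)
Lemma direct_walk x p y : walk x p y -> uniq p -> x \in U -> y \in U' ->
  exists c c' q, [/\ [/\ c \in U, c' \in U' & walk c q c'], uniq q, {subset q <= p} &
    forall u, u \in inner q -> u \notin U :|: U'].
Proof.
have [n] := ubnP (size p); elim: n => // n IHn in x p y *.
rewrite ltnS => le_n wp up xU yU'.
have [/hasP[u]|/hasPn nu] := boolP (has (mem (U :|: U')) (inner p)); last first.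
  by exists x, y, p; split.
case: p wp up le_n => //= e0 p /andP[ex wp] up le_n /mapP[e ep ->].
have {}ep : e \in p := ep.
case/splitPr: ep wp up le_n => p1 p2 /walk_catP[c wp1 /= /andP[/eqP ec wp2]] up le_n.
have up' : uniq ((e0 :: p1) ++ e :: p2) by rewrite cat_cons cons_uniq.
move: up'; rewrite cat_uniq => /and3P[u1 _ u2].
rewrite size_cat /= addnS in le_n.
rewrite inE => /orP[eU|eU'].
  have [|||||c1 [c2 [q [H uq sq dq]]]] := IHn (dtail e) (e :: p2) y.
  - by rewrite /=; move: le_n; clear; lia.
  - by rewrite /= eqxx.
  - exact: u2.
  - exact: eU.
  - exact: yU'.
  by exists c1, c2, q; split=> // z /sq zq; rewrite inE mem_cat zq !orbT.
have [|||||c1 [c2 [q [H uq sq dq]]]] := IHn x (e0 :: p1) (dtail e).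
- by rewrite /=; move: le_n; clear; lia.
- by rewrite /= ex ec.
- exact: u1.
- exact: xU.
- exact: eU'.
exists c1, c2, q; split=> // z /sq; rewrite !inE mem_cat => /orP[->|->] //.
by rewrite orbT.
Qed.

Lemma direct_walks (N : nat) x y (P : nat -> seq (darc D)) :
    x \in U -> y \in U' -> (forall k, k < N -> walk x (P k) y) ->
    (forall k l, k < N -> l < N -> k != l -> ~~ meets (P k) (P l)) ->
  exists w : nat -> vertex D * vertex D * seq (darc D),
    (forall k, k < N -> let: (c, c', q) := w k in
      [/\ [/\ c \in U, c' \in U' & walk c q c'], uniq q, {subset q <= P k} &
        forall u, u \in inner q -> u \notin U :|: U']) /\
    (forall k l, k < N -> l < N -> k != l -> ~~ meets (w k).2 (w l).2).
Proof.
move=> xU yU' wP dP.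
have [k|w Hw] := @seq_choice _ _ (x, y, [::]) (iota 0 N) (fun k g => let: (c, c', q) := g in
      [/\ [/\ c \in U, c' \in U' & walk c q c'], uniq q, {subset q <= P k} &
        forall u, u \in inner q -> u \notin U :|: U']).
  rewrite mem_iota => lt_k; have [p [wp up sp]] := walk_uniq (wP k lt_k).
  have [c [c' [q [H uq sq dq]]]] := direct_walk wp up xU yU'.
  by exists (c, c', q); split=> // e /sq/sp.
have {}Hw k lt_k := Hw k (etrans (mem_iota 0 N k) lt_k).
exists w; split=> // k l lt_k lt_l ne; apply: contra (dP k l lt_k lt_l ne).
have := Hw k lt_k; case: (w k) => [[c c'] q] [_ _ sq _].
have := Hw l lt_l; case: (w l) => [[d d'] q'] [_ _ sq' _].
exact: meetsW.
Qed.

End DirectWalks.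

(** Three times the [m] of the growth argument, plus a bound on the number of vertices in all
    blocks, plus 1 to exceed that bound when endpoints are fixed. *)
Definition step_slots (t K : nat) :=
  3 * (crossing_bound t K + K + 3 * t) + (2 * t + 1) * (2 * t) + 1.

(** Here [n] bounds the number of families, one for each cut of a block and one for each cut of [X].
    Each ordered pair of them is counted with 3 relations: meeting, equal starts, equal ends. *)
Definition step_bound (t K : nat) :=
  let n := (2 * t + 1) * 2 ^ (2 * t) + 2 ^ (2 * t + 1) in
  ramsey_bound (n * n * 3) (step_slots t K).

(** Families are indexed by cuts rather than by pairs of vertices: making walks direct moves their
    ends, but they still cross the cut. Once homogeneity has fixed the ends, a family across every
    cut gives strong connectivity. *)
Lemma growth_step (D : digraph) (t K N : nat) (X : {set vertex D})
    (B : vertex D -> {set vertex D}) :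
    0 < K -> step_bound t K <= N -> #|X| = 2 * t + 1 ->
    (forall x y, x \in X -> y \in X -> x != y -> N <= mu x y) ->
    (forall x, x \in X -> [/\ x \in B x, #|B x| <= 2 * t & rich (B x) N]) ->
  immersion_or_growth t K X B.
Proof.
move=> K_gt0 le_N cardX muX HB.
pose V := vertex D; pose O := ({set V} * option V)%type.
pose S := \bigcup_(x in X) B x.
have cardS : #|S| <= (2 * t + 1) * (2 * t).
  by rewrite -cardX; apply: card_bigcup_leq => x /HB[].
have BS x c : x \in X -> c \in B x -> c \in S by move=> xX cB; apply/bigcupP; exists x.
have [x0 x0X] : exists x0, x0 \in X by apply/card_gt0P; rewrite cardX addn1.
have [x xX|s0 Hs0] := @seq_choice _ _ (fun=> set0) (enum X)
    (fun x (s : nat -> {set darc D}) =>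
      (forall k b b', k < N -> b \in B x -> b' \in B x -> conn (s k) b b') /\
      (forall k l e, k < N -> l < N -> e \in s k -> e \in s l -> k = l)).
  by move: xX; rewrite mem_enum => /HB[].
pose cuts (A : {set V}) := [set A' in powerset A | (A' != set0) && (A' != A)].
have cutsP (A A' : {set V}) : A' \in cuts A -> exists c c', [/\ A' \subset A, c \in A' & c' \in A :\: A'].
  rewrite !inE => /and3P[sA /set0Pn[c cA] neA]; exists c.
  have /set0Pn[c' c'A] : A :\: A' != set0.
    by apply: contra neA; rewrite setD_eq0 eqEsubset sA => ->.
  by exists c'.
pose links : seq O := [seq (A, Some x) | x <- enum X, A <- enum (cuts (B x))].
pose inters : seq O := [seq (A, None) | A <- enum (cuts X)].
pose os := links ++ inters.
have linkP o : o \in links -> exists x, [/\ o.2 = Some x, x \in X & o.1 \in cuts (B x)].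
  by case/allpairsPdep=> x [A []]; rewrite !mem_enum => xX AB ->; exists x.
have interP o : o \in inters -> o.2 = None /\ o.1 \in cuts X.
  by case/mapP=> A; rewrite mem_enum => AX ->.
have card_cuts (A : {set V}) n : #|A| <= n -> #|cuts A| <= 2 ^ n.
  move=> leA; apply: leq_trans (_ : #|powerset A| <= _).
    by apply: subset_leq_card; apply/subsetP=> A'; rewrite inE => /andP[].
  by rewrite card_powerset leq_exp2l.
have size_os : size os <= (2 * t + 1) * 2 ^ (2 * t) + 2 ^ (2 * t + 1).
  rewrite size_cat size_map -cardE leq_add ?card_cuts ?cardX //.
  rewrite size_allpairs_dep sumnE big_map big_enum -cardX -sum_nat_const.
  by apply: leq_sum => x xX; rewrite -cardE card_cuts //; have [] := HB x xX.
pose src (o : O) := if o.2 is Some x then o.1 else \bigcup_(x in o.1) B x.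
pose dst (o : O) := if o.2 is Some x then B x :\: o.1 else \bigcup_(x in X :\: o.1) B x.
pose good o (w : nat -> V * V * seq (darc D)) :=
  [/\ forall k, k < N -> let: (c, c', q) := w k in
      [/\ [/\ c \in src o, c' \in dst o & walk c q c'], uniq q,
        (if o.2 is Some x then {subset q <= s0 x k} else True) &
        forall u, u \in inner q -> u \notin src o :|: dst o] &
      forall k l, k < N -> l < N -> k != l -> ~~ meets (w k).2 (w l).2].
have [o|W0 HW0] := @seq_choice _ _ (fun=> (x0, x0, [::])) os good.
  rewrite mem_cat => /orP[/linkP[x [ox xX /cutsP[c [c' [sA cA c'A]]]]]|].
    have [cs ds] : _ /\ _ := Hs0 x (etrans (mem_enum _ x) xX).
    have [k|P HP] := @seq_choice _ _ [::] (iota 0 N)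
        (fun k p => walk c p c' /\ {subset p <= s0 x k}).
      rewrite mem_iota => lt_k; have [p wp sp] := cs k c c' lt_k (subsetP sA c cA) (subsetP (subsetDl _ _) c' c'A).
      by exists p.
    have {}HP k lt_k := HP k (etrans (mem_iota 0 N k) lt_k).
    have c_src : c \in src o by rewrite /src ox.
    have c_dst : c' \in dst o by rewrite /dst ox.
    have [k lt_k|k l lt_k lt_l ne|w [Hw dw]] := direct_walks (N := N) (P := P) c_src c_dst.
    - by have [] := HP k lt_k.
    - have [_ sk] := HP k lt_k; have [_ sl] := HP l lt_l.
      apply/negP=> /meetsP[e /sk ek /sl el].
      by rewrite (ds k l e lt_k lt_l ek el) eqxx in ne.
    exists w; split=> // k lt_k; have := Hw k lt_k; case: (w k) => [[d d'] q] [H uq sq dq].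
    by rewrite ox; split=> // e /sq; have [_] := HP k lt_k; apply.
  case/interP=> oi /cutsP[x [y [sA xA yA]]].
  have xX : x \in X by apply: subsetP xA.
  have [yX nyA] : y \in X /\ y \notin o.1 by move: yA; rewrite inE => /andP[].
  have ne_xy : x != y by apply: contraNneq nyA => <-.
  have [[xB _ _] [yB _ _]] := (HB x xX, HB y yX).
  have x_src : x \in src o by rewrite /src oi; apply/bigcupP; exists x.
  have y_dst : y \in dst o by rewrite /dst oi; apply/bigcupP; exists y.
  have [P0 [HP0 dP0]] := (leq_mu x y N).1 (muX x y xX yX ne_xy).
  pose P k := if insub k is Some i then P0 i else [::].
  have PE k (lt_k : k < N) : P k = P0 (Ordinal lt_k) by rewrite /P insubT.
  have [k lt_k|k l lt_k lt_l ne|w [Hw dw]] := direct_walks (N := N) (P := P) x_src y_dst.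
  - by rewrite PE; have [] := dipath_walk (HP0 (Ordinal lt_k)).
  - by rewrite !PE /meets -disjoint_has dP0.
  exists w; split=> // k lt_k; have := Hw k lt_k; case: (w k) => [[d d'] q] [H uq sq dq].
  by rewrite oi.
(* Homogeneity fixes which families meet, and also, since there are more slots
   than vertices in the blocks, the endpoints of each family. *)
pose R (j : O * O * option bool) k l := let: (o, o', c) := j in
  match c with
  | None => meets (W0 o k).2 (W0 o' l).2
  | Some true => (W0 o k).1.1 == (W0 o l).1.1
  | Some false => (W0 o k).1.2 == (W0 o l).1.2
  end.
pose js := [seq (oo, c) | oo <- [seq (o, o') | o <- os, o' <- os], c <- enum {: option bool}].
set M := step_slots t K.
have [|f' [sub_f size_f hom_f]] := @ramsey _ _ R js M (iota 0 N).
  rewrite size_iota; apply: leq_trans le_N; apply: ramsey_bound_mono.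
  by rewrite !size_allpairs -cardE card_option card_bool leq_mul2r leq_mul ?orbT.
pose f := nth 0 f'.
have ltf k : k < M -> f k < N.
  move=> lt_k; have : f k \in iota 0 N by rewrite (mem_subseq sub_f) ?mem_nth ?size_f.
  by rewrite mem_iota.
have injf k l : k < M -> l < M -> k != l -> f k != f l.
  by move=> lt_k lt_l; rewrite nth_uniq ?size_f // (subseq_uniq sub_f) ?iota_uniq.
have hom j : j \in js -> (forall k l, k < l -> l < M -> R j (f k) (f l)) \/
    (forall k l, k < l -> l < M -> ~~ R j (f k) (f l)).
  case/hom_f=> /(pairwiseP 0) H; [left|right] => k l lt_kl lt_l;
    by apply: H; rewrite ?inE ?size_f // (ltn_trans lt_kl).
have js_in o o' c : o \in os -> o' \in os -> (o, o', c) \in js.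
  by move=> oo oo'; rewrite allpairs_f ?mem_enum // allpairs_f.
pose W o k := (W0 o (f k)).2; pose tl o := (W0 o (f 0)).1.1; pose hd o := (W0 o (f 0)).1.2.
have M_gt : (2 * t + 1) * (2 * t) < M by rewrite /M /step_slots; clear; lia.
have src_S o : o \in os -> src o \subset S /\ dst o \subset S.
  rewrite mem_cat /src /dst => /orP[/linkP[x [-> xX]]|/interP[-> ]]; rewrite !inE => /and3P[sA _ _].
    split; apply/subsetP=> c; rewrite ?inE => cA; apply: (BS x) => //.
      by apply: subsetP cA.
    by case/andP: cA.
  split; apply/subsetP=> c /bigcupP[x xA cB]; apply: BS cB.
    exact: subsetP xA.
  by move: xA; rewrite inE => /andP[].
have Hw o k : o \in os -> k < M ->
    [/\ [/\ tl o \in src o, hd o \in dst o & walk (tl o) (W o k) (hd o)], uniq (W o k),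
      (if o.2 is Some x then {subset W o k <= s0 x (f k)} else True) &
      forall u, u \in inner (W o k) -> u \notin src o :|: dst o].
  move=> oo lt_k; have [Hgood _] := HW0 o oo; have [sS dS] := src_S o oo.
  have eq_tl : (W0 o (f k)).1.1 = tl o.
    apply: (@constant_on_homogeneous _ S M (fun k => (W0 o (f k)).1.1)) => //.
    - exact: leq_ltn_trans cardS M_gt.
    - move=> l lt_l; apply: (subsetP sS); have := Hgood _ (ltf l lt_l).
      by case: (W0 o (f l)) => [[c c'] q] [[]].
    - exact: hom (o, o, Some true) (js_in _ _ _ oo oo).
  have eq_hd : (W0 o (f k)).1.2 = hd o.
    apply: (@constant_on_homogeneous _ S M (fun k => (W0 o (f k)).1.2)) => //.
    - exact: leq_ltn_trans cardS M_gt.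
    - move=> l lt_l; apply: (subsetP dS); have := Hgood _ (ltf l lt_l).
      by case: (W0 o (f l)) => [[c c'] q] [[]].
    - exact: hom (o, o, Some false) (js_in _ _ _ oo oo).
  rewrite -eq_tl -eq_hd /W; have := Hgood _ (ltf k lt_k).
  by case: (W0 o (f k)) => [[c c'] q].
have M1 : 1 < M by rewrite /M /step_slots /crossing_bound; clear; lia.
have M0 : 0 < M by apply: ltnW.
have W_hom o o' k l : o \in os -> o' \in os -> k < l -> l < M ->
    meets (W o k) (W o' l) = meets (W o 0) (W o' 1).
  move=> oo oo' lt_kl lt_l.
  case: (hom (o, o', None) (js_in _ _ _ oo oo')) => H.
    by rewrite [LHS]H // [RHS]H.
  by rewrite [LHS](negPf (H _ _ lt_kl lt_l)) [RHS](negPf (H 0 1 _ _)).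
have link_os x (A : {set V}) : x \in X -> A \subset B x -> A != set0 -> A != B x -> (A, Some x) \in os.
  move=> xX sA nA nA'; rewrite mem_cat; apply/orP; left.
  by apply/allpairsPdep; exists x, A; rewrite !mem_enum !inE xX sA nA nA'.
have inter_os (A : {set V}) : A \subset X -> A != set0 -> A != X -> (A, None) \in os.
  move=> sA nA nA'; rewrite mem_cat; apply/orP; right.
  by apply/mapP; exists A; rewrite // mem_enum !inE sA nA nA'.
have owner_os o x : o \in os -> o.2 = Some x -> x \in X /\ o.1 \subset B x.
  rewrite mem_cat => /orP[/linkP[y [-> yX]]|/interP[-> //]].
  by rewrite !inE => /andP[sA _] [<-].
have link_connect x b b' : x \in X -> b \in B x -> b' \in B x ->
    connect (arrow tl hd [seq o <- os | o.2 == Some x]) b b'.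
  move=> xX; apply: cut_connect => A sA nA nA'; exists (A, Some x).
  have oo := link_os x A xX sA nA nA'; have [[h1 h2 _] _ _ _] := Hw _ 0 oo M0.
  by rewrite mem_filter eqxx oo.
have os_connect c c' : c \in S -> c' \in S -> connect (arrow tl hd os) c c'.
  have link_connect' x b b' : x \in X -> b \in B x -> b' \in B x ->
      connect (arrow tl hd os) b b'.
    move=> xX bB b'B; apply: connect_arrow_sub (link_connect x b b' xX bB b'B).
    by move=> o; rewrite mem_filter => /andP[].
  case/bigcupP=> x xX cB /bigcupP[y yX c'B].
  have [[xB _ _] [yB _ _]] := (HB x xX, HB y yX).
  apply: connect_trans (link_connect' x _ _ xX cB xB) _.
  apply: connect_trans _ (link_connect' y _ _ yX yB c'B).
  (* The family of the cut [A] would lead out of [A], whichever vertices of the blocks it joins,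
     since blocks are already connected by their links. *)
  apply/negPn/negP => nc; pose A := [set z in X | connect (arrow tl hd os) x z].
  have oo : (A, None) \in os.
    apply: inter_os.
    - by apply/subsetP=> z; rewrite inE => /andP[].
    - by apply/set0Pn; exists x; rewrite inE xX connect0.
    - by apply: contraNneq nc => eA; move: yX; rewrite -eA inE => /andP[].
  have [[/bigcupP[z1 z1A tB] /bigcupP[z2 z2A hB] _] _ _ _] := Hw _ 0 oo M0.
  move: z1A z2A; rewrite !inE => /andP[z1X c1] /andP[/negP nz2 z2X].
  have [[z1B _ _] [z2B _ _]] := (HB z1 z1X, HB z2 z2X).
  apply: nz2; rewrite z2X /=; apply: connect_trans c1 _.
  apply: connect_trans (link_connect' z1 _ _ z1X z1B tB) _.
  apply: connect_trans (connect1 (arrowP tl hd oo)) _.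
  exact: link_connect' z2X hB z2B.
have end_S o : o \in os -> tl o \in S /\ hd o \in S.
  move=> oo; have [sS dS] := src_S o oo; have [[h1 h2 _] _ _ _] := Hw o 0 oo M0.
  by rewrite (subsetP sS) ?(subsetP dS).
have W_disj o k l : o \in os -> k < M -> l < M -> k != l -> ~~ meets (W o k) (W o l).
  by move=> oo lt_k lt_l ne; have [_ dw] := HW0 o oo; apply: dw; rewrite ?ltf ?injf.
have Hs x : x \in X -> _ := fun xX => Hs0 x (etrans (mem_enum _ x) xX).
have [/hasP[F oF /hasP[G oG cFG]]|ncross] := boolP (has (fun F => has (crossing_pair W F) os) os).
  have [_ hG] := end_S G oG; have [tF _] := end_S F oF.
  have [r [wr _ sr]] := connect_route (os_connect _ _ hG tF).
  apply: (@crossing_cycle D t K (crossing_bound t K + K + 3 * t) M X B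
    (fun x k => s0 x (f k)) O snd os W tl hd _ _ _ _ _ _ W_disj W_hom _ _ _ _ _ _ F G r) => //.
  - by split=> //; clear; lia.
  - by rewrite /M /step_slots; clear; lia.
  - by move=> x k b b' xX lt_k; have [cs _] := Hs x xX; apply: cs; apply: ltf.
  - move=> x k l e xX lt_k lt_l e1 e2; have [_ ds] := Hs x xX; apply/eqP/negPn/negP => ne.
    by case/eqP: (injf k l lt_k lt_l ne); apply: ds e1 e2; apply: ltf.
  - by move=> o k oo lt_k; have [[_ _]] := Hw o k oo lt_k.
  - by move=> o k oo lt_k; have [_] := Hw o k oo lt_k.
  - move=> o x oo ox; have [xX sA] := owner_os o x oo ox.
    have [[h1 h2 _] _ _ _] := Hw o 0 oo M0; move: h1 h2; rewrite /src /dst ox => h1.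
    by rewrite inE => /andP[_ h2]; split=> //; apply: subsetP h1.
  - by move=> o x k oo ox lt_k; have [_ _] := Hw o k oo lt_k; rewrite ox.
  - move=> o x k u oo ox lt_k iu; have [xX sA] := owner_os o x oo ox.
    have [_ _ _ /(_ u iu)] := Hw o k oo lt_k; rewrite /src /dst ox !inE negb_or.
    by case/andP=> nu; rewrite nu.
  - by move=> o oo _; apply: end_S.
  - move=> o k u oo oi lt_k iu; have [_ _ _ /(_ u iu)] := Hw o k oo lt_k.
    apply: contra => /bigcupP[x xX uB]; rewrite /src /dst oi inE.
    have [xA|nxA] := boolP (x \in o.1); apply/orP; [left|right]; apply/bigcupP; exists x => //.
    by rewrite inE nxA.
  - move=> x b b' xX bB b'B.
    have [r' [wr' lt_r sr']] := connect_route (link_connect x b b' xX bB b'B).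
    by exists r'; split=> // o /sr'; rewrite mem_filter => /andP[/eqP].
(* Without crossings, all walks in slot [k] together form the [k]-th arc set: different slots are
   disjoint, and meetings within a slot do no harm. *)
left; apply: (@rich_immersion D (onion_star t) x0 X M); last 2 first.
- by rewrite cardX card_onion_vertex.
- by apply: leq_trans (card_onion_arc t) _; rewrite /M /step_slots; clear; lia.
exists (fun k => [set e in flatten [seq W o k | o <- os]]); split=> [k b b' lt_k bX b'X|].
  have inS x : x \in X -> x \in S by move=> xX; have [xB _ _] := HB x xX; apply: BS xB.
  have [r [wr _ sr]] := connect_route (os_connect _ _ (inS b bX) (inS b' b'X)).
  exists (flatten [seq W o k | o <- r]).
    by apply: (route_walk (os := os) (M := M)) wr lt_k => // o j oo lt_j; have [[_ _]] := Hw o j oo lt_j.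
  by move=> e /flatten_mapP[o or eo]; rewrite inE; apply/flatten_mapP; exists o; rewrite ?sr.
move=> k l e lt_k lt_l; rewrite !inE => /flatten_mapP[o oo eo] /flatten_mapP[o' oo' eo'].
apply/eqP/negPn/negP => ne.
have nc : ~~ crossing_pair W o o' by apply: contra ncross => cr; apply/hasP; exists o => //; apply/hasP; exists o'.
move: nc; rewrite negb_or => /andP[n1 n2].
have [lt|lt|/eqP] := ltngtP k l; last by rewrite (negPf ne).
  by case/negP: n1; rewrite -(W_hom o o' k l) //; apply/meetsP; exists e.
by case/negP: n2; rewrite -(W_hom o' o l k) //; apply/meetsP; exists e.
Qed.

(** [n] counts the rounds left. The sum provides both the slots that a round needs and the [K] that
    untouched blocks must keep. At the end every arc of the star needs a slot. *)
Fixpoint growth_bound (t n : nat) : nat :=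
  if n is n'.+1 then
    let K := growth_bound t n' in K + step_bound t K
  else 6 * t + 1.

Lemma growth_bound_ge t n : 6 * t < growth_bound t n.
Proof. by elim: n => [|n IHn] /=; [rewrite addn1|apply: leq_trans IHn (leq_addr _ _)]. Qed.

(** The number of vertices that the blocks lack to have size [2 * t + 1] drops in each round, until
    a block is full or a round yields the immersion itself. *)
Lemma blocks_immersion (n : nat) (D : digraph) (t : nat) (X : {set vertex D})
    (B : vertex D -> {set vertex D}) :
    #|X| = 2 * t + 1 ->
    (forall x y, x \in X -> y \in X -> x != y -> growth_bound t n <= mu x y) ->
    (forall x, x \in X -> x \in B x /\ rich (B x) (growth_bound t n)) ->
    \sum_(x in X) (2 * t + 1 - #|B x|) <= n ->
  contains_immersion D (onion_star t).
Proof.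
elim: n B => [|n IHn] B cardX muX HB le_n.
  have [x0 x0X] : exists x0, x0 \in X by apply/card_gt0P; rewrite cardX addn1.
  have [_ rB] := HB x0 x0X.
  apply: (rich_immersion x0 rB); last exact: leq_trans (card_onion_arc t) (ltnW (growth_bound_ge t 0)).
  apply: leq_trans (card_onion_vertex t) _; rewrite -subn_eq0 -leqn0.
  by apply: leq_trans le_n; rewrite (bigD1 x0) //= leq_addr.
have [/existsP[x /andP[xX big]]|] := boolP [exists x, (x \in X) && (2 * t < #|B x|)].
  have [_ rB] := HB x xX.
  apply: (rich_immersion x rB); last exact: leq_trans (card_onion_arc t) (ltnW (growth_bound_ge t _)).
  by apply: leq_trans (card_onion_vertex t) _; rewrite addn1.
rewrite negb_exists => /forallP small.
have small' x : x \in X -> #|B x| <= 2 * t.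
  by move=> xX; have := small x; rewrite xX /= -leqNgt.
have [||||x xX|imm|[x [u [xX uB rBu]]]] := @growth_step D t (growth_bound t n) (growth_bound t n.+1) X B.
- exact: leq_ltn_trans (leq0n _) (growth_bound_ge t n).
- exact: leq_addl.
- exact: cardX.
- exact: muX.
- by have [xB rB] := HB x xX; split=> //; apply: small'.
- exact: imm.
apply: (IHn (fun y => if y == x then u |: B x else B y)) => //.
- by move=> y z yX zX ne; apply: leq_trans (muX y z yX zX ne); apply: leq_addr.
- move=> y yX; have [yB rB] := HB y yX; case: eqP => [eq_y|_].
    by rewrite eq_y inE -eq_y yB orbT eq_y.
  by split=> //; apply: rich_leq rB; apply: leq_addr.
move: le_n; rewrite (bigD1 x) //= [in X in _ -> X](bigD1 x) //= eqxx cardsU1 uB.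
rewrite [in X in _ -> X](eq_bigr (fun y => 2 * t + 1 - #|B y|)); last first.
  by move=> y /andP[_ /negPf->].
by have := small' x xX; lia.
Qed.


Theorem theorem1p3 :
  exists f : nat -> nat,
    (forall t : nat, 0 < t -> 0 < f t) /\
    forall (t : nat) (D : digraph) (X : {set vertex D}),
      0 < t ->
      #|X| = 2 * t + 1 ->
      (forall x y : vertex D, x \in X -> y \in X -> x != y -> f t < mu x y) ->
      contains_immersion D (onion_star t).
Proof.
(* Each of the [2 * t + 1] blocks lacks at most [2 * t + 1] vertices. *)
exists (fun t => growth_bound t ((2 * t + 1) * (2 * t + 1))); split=> [t _|t D X _ cardX muX].
  exact: leq_ltn_trans (leq0n _) (growth_bound_ge _ _).
apply: (@blocks_immersion ((2 * t + 1) * (2 * t + 1)) D t X (fun x => [set x])) => //.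
- by move=> x y xX yX ne; apply/ltnW/muX.
- by move=> x _; split; [apply: set11|apply: rich_set1].
apply: leq_trans (_ : \sum_(x in X) (2 * t + 1) <= _); last by rewrite sum_nat_const cardX.
by apply: leq_sum => x _; apply: leq_subr.
Qed.
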